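(* Let $S$ be a commutative linearly topologized ring and let $R$ be an $S$-algebra such that $R$ is finitely presented and Hausdorff as an $S$-module. Then: (i) If $S$ is quasi-$\pi_\infty$-regular, then $R$ is quasi-$\pi_\infty$-regular (with respect to some linear ring topology). If moreover $S$ is semiperfect, then so is $R$. (ii) If $S$ satisfies $\mathcal{P}\in\mathscr{P}_{\mathrm{top}}\cap\mathscr{P}_{\mathrm{mor}}$ with respect to its given topology and this topology is also first countable, then $R$ satisfies $\mathcal{P}$ (with respect to some linear ring topology).
   Context: All rings are unital; $R$ need not be commutative. A topological ring is linearly topologized (LT) if it has a basis of neighborhoods of $0$ (a local basis) consisting of two-sided ideals; such a topology is called linear; $\mathcal{I}_R$ is the set of open (two-sided) ideals. It is first countable if it has a countable local basis. An $S$-module $M$ is Hausdorff if it is Hausdorff in the topology with basis of neighborhoods $\{x+MJ:J\in\mathcal{I}_S\}$ at $x\in M$, i.e. $\bigcap_{J\in\mathcal{I}_S}MJ=0$. $\mathscr{P}_{\mathrm{disc}}$ is the set of properties: semiprimary; right perfect; left perfect; $\pi_\infty$-regular and semiperfect; $\pi_\infty$-regular; $\pi$-regular and semiperfect; $\pi$-regular. $\mathscr{P}_{\mathrm{top}}$ is the set of properties of LT rings: pro-$\mathcal{Q}$, and pro-$\mathcal{Q}$ and semiperfect, for $\mathcal{Q}\in\mathscr{P}_{\mathrm{disc}}$; quasi-$\mathcal{Q}$, and quasi-$\mathcal{Q}$ and semiperfect, for $\mathcal{Q}\in\{\pi_\infty\text{-regular},\pi\text{-regular}\}$. A non-topological ring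 satisfies a property in $\mathscr{P}_{\mathrm{top}}$ if it does so for some linear ring topology. $\mathscr{P}_{\mathrm{mor}}$ is the set of properties in $\mathscr{P}_{\mathrm{disc}}\cup\mathscr{P}_{\mathrm{top}}$ preserved under Morita equivalence; for a property in $\mathscr{P}_{\mathrm{top}}$ this means that whenever a Hausdorff LT ring $R$ has it, so do $\mathrm{M}_n(R)$ (with local basis $\{\mathrm{M}_n(I):I\in\mathcal{I}_R\}$) and $eRe$ (induced topology) for every idempotent $e$ such that $eR$ is a progenerator. Definitions: $R$ is semilocal if $R/\mathrm{Jac}(R)$ is semisimple artinian; semiperfect if semilocal and idempotents lift modulo $\mathrm{Jac}(R)$; semiprimary if semilocal with $\mathrm{Jac}(R)$ nilpotent; right (left) perfect if semilocal and for every sequence $x_1,x_2,\dots\in\mathrm{Jac}(R)$ the sequence $x_1,x_2x_1,x_3x_2x_1,\dots$ (resp. $x_1,x_1x_2,x_1x_2x_3,\dots$) eventually vanishes. $R$ is $\pi$-regular if for every $a\in R$ the chain $aR\supseteq a^2R\supseteq\cdots$ stabilizes; $\pi_\infty$-regular if $\mathrm{M}_n(R)$ is $\pi$-regular for all $n$. A topological ring is pro-$\mathcal{Q}$ if it is isomorphic as a topological ring to the inverse limit of an inverse system of discrete rings satisfying $\mathcal{Q}$. A Hausdorff LT ring $R$ is quasi-$\pi$-regular if for every $a\in R$ there is an idempotent $e\in R$ such that, with $f:=1-e$: $a=eae+faf$; $eae$ is invertible in $eRe$; and $(faf)^n\to0$ as $n\to\infty$. It is quasi-$\pi_\infty$-regular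 if $\mathrm{M}_n(R)$ (with the ring topology having local basis $\{\mathrm{M}_n(I):I\in\mathcal{I}_R\}$) is quasi-$\pi$-regular for all $n$. *)

(* Defs.v *)
From HB Require Import structures.
From mathcomp Require Import all_boot all_algebra.
From mathcomp Require Import boolp classical_sets functions cardinality.
From mathcomp Require Import topology separation_axioms function_spaces.

Set Implicit Arguments.
Unset Strict Implicit.
Unset Printing Implicit Defensive.

Import GRing.Theory.
Local Open Scope classical_set_scope.
Local Open Scope ring_scope.

(* Rings are pzRingType's, so that the zero ring is allowed. *)

Section Ideals.
Variable R : pzRingType.
Implicit Type I : set R.

Definition right_ideal I : Prop :=
  [/\ I 0, forall x y, I x -> I y -> I (x - y) & forall x a, I x -> I (x * a)].

Definition two_sided_ideal I : Prop :=
  right_ideal I /\ forall x a, I x -> I (a * x).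

Definition maximal_right_ideal I : Prop :=
  [/\ right_ideal I, I <> setT &
      forall J, right_ideal J -> I `<=` J -> J = I \/ J = setT].

Definition Jac : set R := \bigcap_(I in maximal_right_ideal) I.

End Ideals.
Arguments Jac R : clear implicits.

Definition right_semisimple (Q : pzRingType) : Prop :=
  forall I : set Q, right_ideal I -> exists J : set Q,
    [/\ right_ideal J, I `&` J = [set 0] &
        forall x, exists y z, [/\ I y, J z & x = y + z]].

Definition right_artinian (Q : pzRingType) : Prop :=
  forall I : nat -> set Q, (forall k, right_ideal (I k)) ->
    (forall k, I k.+1 `<=` I k) ->
    exists n, forall m, (n <= m)%N -> I m = I n.

(* The quotient R / Jac(R) is presented by a surjective ring homomorphism with
   kernel Jac(R). *)
Definition semilocal (R : pzRingType) : Prop :=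
  exists (Q : pzRingType) (p : {rmorphism R -> Q}),
    [/\ set_surj setT setT p, p @^-1` [set 0] = Jac R,
        right_semisimple Q & right_artinian Q].

Definition idempotents_lift_mod_Jac (R : pzRingType) : Prop :=
  forall x : R, Jac R (x * x - x) ->
    exists e : R, e * e = e /\ Jac R (e - x).

Definition semiperfect (R : pzRingType) : Prop :=
  semilocal R /\ idempotents_lift_mod_Jac R.

Definition semiprimary (R : pzRingType) : Prop :=
  semilocal R /\
  exists n, forall x : 'I_n -> R, (forall i, Jac R (x i)) ->
    \prod_(i < n) x i = 0.

Fixpoint left_growing_prod (R : pzRingType) (x : nat -> R) (n : nat) : R :=
  if n is k.+1 then x n * left_growing_prod x k else x 0%N.

Fixpoint right_growing_prod (R : pzRingType) (x : nat -> R) (n : nat) : R :=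
  if n is k.+1 then right_growing_prod x k * x n else x 0%N.

Definition right_perfect (R : pzRingType) : Prop :=
  semilocal R /\
  forall x : nat -> R, (forall i, Jac R (x i)) ->
    exists n, forall m, (n <= m)%N -> left_growing_prod x m = 0.

Definition left_perfect (R : pzRingType) : Prop :=
  semilocal R /\
  forall x : nat -> R, (forall i, Jac R (x i)) ->
    exists n, forall m, (n <= m)%N -> right_growing_prod x m = 0.

Definition pi_regular (R : pzRingType) : Prop :=
  forall a : R, exists n, forall m, (n <= m)%N ->
    [set a ^+ m * x | x in [set: R]] = [set a ^+ n * x | x in [set: R]].

Definition pi_inf_regular (R : pzRingType) : Prop :=
  forall n, (0 < n)%N -> pi_regular 'M[R]_n.

(* A ring has to be considered with several topologies, so topologies are
   first-class values; [topologized tau] is the corresponding topologicalType. *)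
Record topology (X : Type) := Topology {
  is_open : set (set X);
  is_openT : is_open setT;
  is_openI : setI_closed is_open;
  is_open_bigU : forall (I : Type) (f : I -> set X),
    (forall i, is_open (f i)) -> is_open (\bigcup_i f i)
}.

Definition topologized (X : Type) (tau : topology X) : Type := X.

HB.instance Definition _ (X : choiceType) (tau : topology X) :=
  Choice.on (topologized tau).
HB.instance Definition _ (X : choiceType) (tau : topology X) :=
  isOpenTopological.Build (topologized tau)
    (is_openT tau) (@is_openI _ tau) (@is_open_bigU _ tau).

Definition topology_of (T : topologicalType) : topology T :=
  @Topology T open openT (@openI T)
    (fun I f fo => bigcup_open (fun i _ => fo i)).

Section LinearTopology.
Variables (R : pzRingType) (tau : topology R).
Local Notation T := (topologized tau).

Definition ring_topology : Prop :=
  [/\ continuous (fun p : T * T => (p.1 : R) + (p.2 : R) : T),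
      continuous (fun x : T => - (x : R) : T) &
      continuous (fun p : T * T => (p.1 : R) * (p.2 : R) : T)].

Definition local_basis (B : set (set R)) : Prop :=
  (forall U, B U -> nbhs (0 : T) U) /\
  (forall U, nbhs (0 : T) U -> exists2 V, B V & V `<=` U).

Definition linear_ring_topology : Prop :=
  ring_topology /\
  exists2 B, local_basis B & forall I, B I -> two_sided_ideal I.

Definition first_countable_ring : Prop := exists2 B, countable B & local_basis B.

Definition hausdorff_ring : Prop := hausdorff_space T.

Definition open_ideal : set (set R) :=
  [set I | two_sided_ideal I /\ is_open tau I].

End LinearTopology.

Definition mx_over (R : pzRingType) n (I : set R) : set 'M[R]_n :=
  [set A | forall i j, I (A i j)].

Section MatrixTopology.
Variables (R : pzRingType) (tau : topology R) (n : nat).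

Definition mx_is_open (U : set 'M[R]_n) : Prop :=
  forall A, U A -> exists2 I, open_ideal tau I &
    forall X, mx_over I X -> U (A + X).

Fact mx_is_openT : mx_is_open setT.
Proof.
move=> A _; exists setT => //; split; last exact: is_openT.
by split=> //; split.
Qed.

Fact mx_is_openI : setI_closed mx_is_open.
Proof.
move=> U V oU oV A [UA VA].
have [I [[[I0 IB IM] IL] oI] IU] := oU A UA.
have [J [[[J0 JB JM] JL] oJ] JV] := oV A VA.
exists (I `&` J).
  split; last exact: is_openI.
  split; [split=> // | by move=> x a [/IL ? /JL ?]].
  - by move=> x y [Ix Jx] [Iy Jy]; split; [apply: IB | apply: JB].
  - by move=> x a [/IM ? /JM ?].
move=> X IJX; split; [apply: IU | apply: JV] => i j; by have [] := IJX i j.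
Qed.

Fact mx_is_open_bigU (K : Type) (f : K -> set 'M[R]_n) :
  (forall k, mx_is_open (f k)) -> mx_is_open (\bigcup_k f k).
Proof.
move=> of_ A [k _ fkA]; have [I oI If] := of_ k A fkA.
by exists I => // X /If fX; exists k.
Qed.

Definition mx_topology : topology 'M[R]_n :=
  Topology mx_is_openT mx_is_openI mx_is_open_bigU.

Lemma mx_topology_local_basis :
  local_basis mx_topology [set @mx_over R n I | I in open_ideal tau].
Proof.
split=> [_ [I [[[I0 IB IM] IL] oI] <-]|U [V [/= oV V0 VU]]].
  exists (mx_over I); split=> //= => [A IA|i j]; last by rewrite mxE.
  exists I => // X IX i j; rewrite mxE -[X i j]opprK.
  by apply: (IB) => //; rewrite -sub0r; apply: (IB).
have [I oI IV] := oV _ V0.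
by exists (mx_over I); [exists I | move=> X /IV; rewrite add0r => /VU].
Qed.

End MatrixTopology.

Definition quasi_pi_regular (R : pzRingType) (tau : topology R) : Prop :=
  [/\ linear_ring_topology tau, hausdorff_ring tau &
   forall a : R, exists e : R, let f := 1 - e in
     [/\ e * e = e,
         a = e * a * e + f * a * f,
         exists b : R, [/\ b = e * b * e, (e * a * e) * b = e &
                           b * (e * a * e) = e] &
         (fun n => (f * a * f) ^+ n : topologized tau) @ \oo
           --> (0 : topologized tau)]].

Definition quasi_pi_inf_regular (R : pzRingType) (tau : topology R) : Prop :=
  [/\ linear_ring_topology tau, hausdorff_ring tau &
   forall n, (0 < n)%N -> quasi_pi_regular (mx_topology tau n)].

Record inverse_system := InverseSystem {
  isys_index : Type;
  isys_le : isys_index -> isys_index -> Prop;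
  isys_refl : forall i, isys_le i i;
  isys_trans : forall i j k, isys_le i j -> isys_le j k -> isys_le i k;
  isys_inhabited : inhabited isys_index;
  isys_directed : forall i j, exists k, isys_le i k /\ isys_le j k;
  isys_ring :> isys_index -> pzRingType;
  isys_map : forall i j, isys_le i j -> {rmorphism isys_ring j -> isys_ring i};
  isys_map_id : forall i (h : isys_le i i) x, isys_map h x = x;
  isys_map_comp : forall i j k (hij : isys_le i j) (hjk : isys_le j k)
    (hik : isys_le i k) x, isys_map hij (isys_map hjk x) = isys_map hik x
}.

Section ProductRing.
Variables (I : Type) (X : I -> pzRingType).

Definition product_ring : Type := forall i, X i.
HB.instance Definition _ := Choice.on product_ring.

Implicit Types x y z : product_ring.
Let add x y : product_ring := fun i => x i + y i.
Let opp x : product_ring := fun i => - x i.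
Let mul x y : product_ring := fun i => x i * y i.

Fact product_addA : associative add.
Proof. by move=> x y z; apply: functional_extensionality_dep => i; exact: addrA. Qed.
Fact product_addC : commutative add.
Proof. by move=> x y; apply: functional_extensionality_dep => i; exact: addrC. Qed.
Fact product_add0 : left_id (fun=> 0) add.
Proof. by move=> x; apply: functional_extensionality_dep => i; exact: add0r. Qed.
Fact product_addN : left_inverse (fun=> 0) opp add.
Proof. by move=> x; apply: functional_extensionality_dep => i; exact: addNr. Qed.
HB.instance Definition _ := GRing.isZmodule.Build product_ring
  product_addA product_addC product_add0 product_addN.

Fact product_mulA : associative mul.
Proof. by move=> x y z; apply: functional_extensionality_dep => i; exact: mulrA. Qed.
Fact product_mul1 : left_id (fun=> 1) mul.
Proof. by move=> x; apply: functional_extensionality_dep => i; exact: mul1r. Qed.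
Fact product_mulr1 : right_id (fun=> 1) mul.
Proof. by move=> x; apply: functional_extensionality_dep => i; exact: mulr1. Qed.
Fact product_mulDl : left_distributive mul +%R.
Proof. by move=> x y z; apply: functional_extensionality_dep => i; exact: mulrDl. Qed.
Fact product_mulDr : right_distributive mul +%R.
Proof. by move=> x y z; apply: functional_extensionality_dep => i; exact: mulrDr. Qed.
HB.instance Definition _ := GRing.Zmodule_isPzRing.Build product_ring
  product_mulA product_mul1 product_mulr1 product_mulDl product_mulDr.

End ProductRing.

Section InverseLimit.
Variable D : inverse_system.

Definition compatible : {pred product_ring D} :=
  fun x => `[< forall i j (h : isys_le i j), isys_map h (x j) = x i >].

Fact compatible_subring : subring_closed compatible.
Proof.
split=> [|x y /asboolP cx /asboolP cy|x y /asboolP cx /asboolP cy];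
  apply/asboolP => i j h.
- exact: rmorph1.
- by rewrite -[RHS]/(x i - y i) -(cx _ _ h) -(cy _ _ h) -rmorphB.
- by rewrite -[RHS]/(x i * y i) -(cx _ _ h) -(cy _ _ h) -rmorphM.
Qed.

Definition inverse_limit : Type := {x : product_ring D | x \in compatible}.
HB.instance Definition _ := SubChoice.on inverse_limit.
HB.instance Definition _ :=
  GRing.SubChoice_isSubPzRing.Build (product_ring D) (mem compatible)
    inverse_limit compatible_subring.

Definition inverse_limit_topology : topology inverse_limit :=
  topology_of (initial_topology
    (val : inverse_limit -> prod_topology (fun i => discrete_topology (D i)))).

End InverseLimit.

Definition topological_ring_iso (R R' : pzRingType)
    (tau : topology R) (tau' : topology R') : Prop :=
  exists (f : {rmorphism R -> R'}) (g : R' -> R),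
    [/\ cancel f g, cancel g f,
        continuous (f : topologized tau -> topologized tau') &
        continuous (g : topologized tau' -> topologized tau)].

Definition pro (Q : pzRingType -> Prop) (R : pzRingType) (tau : topology R) :
    Prop :=
  exists D : inverse_system,
    (forall i, Q (D i)) /\ topological_ring_iso tau (inverse_limit_topology D).

Inductive disc_property :=
  | Semiprimary | RightPerfect | LeftPerfect
  | PiInfRegularSemiperfect | PiInfRegular
  | PiRegularSemiperfect | PiRegular.

Definition has_disc (Q : disc_property) (R : pzRingType) : Prop :=
  match Q with
  | Semiprimary => semiprimary R
  | RightPerfect => right_perfect R
  | LeftPerfect => left_perfect R
  | PiInfRegularSemiperfect => pi_inf_regular R /\ semiperfect R
  | PiInfRegular => pi_inf_regular R
  | PiRegularSemiperfect => pi_regular R /\ semiperfect R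
  | PiRegular => pi_regular R
  end.

Inductive top_property :=
  | Pro of disc_property | ProSemiperfect of disc_property
  | QuasiPiInfRegular | QuasiPiInfRegularSemiperfect
  | QuasiPiRegular | QuasiPiRegularSemiperfect.

Definition has_top (P : top_property) (R : pzRingType) (tau : topology R) :
    Prop :=
  match P with
  | Pro Q => pro (has_disc Q) tau
  | ProSemiperfect Q => pro (has_disc Q) tau /\ semiperfect R
  | QuasiPiInfRegular => quasi_pi_inf_regular tau
  | QuasiPiInfRegularSemiperfect => quasi_pi_inf_regular tau /\ semiperfect R
  | QuasiPiRegular => quasi_pi_regular tau
  | QuasiPiRegularSemiperfect => quasi_pi_regular tau /\ semiperfect R
  end.

Record idempotent_of (R : pzRingType) := IdempotentOf {
  idem_val : R;
  idem_mul : idem_val * idem_val = idem_val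
}.

Section Corner.
Variables (R : pzRingType) (idem : idempotent_of R).
Local Notation e := (idem_val idem).

Definition in_corner : {pred R} := fun x => e * x * e == x.

Fact in_corner_zmod : zmod_closed in_corner.
Proof.
split=> [|x y /eqP xE /eqP yE]; rewrite unfold_in /in_corner.
  by rewrite mulr0 mul0r.
by rewrite mulrBr mulrBl xE yE.
Qed.

HB.instance Definition _ := GRing.isZmodClosed.Build R in_corner in_corner_zmod.

Definition corner : Type := {x : R | x \in in_corner}.
HB.instance Definition _ := SubChoice.on corner.
HB.instance Definition _ := [SubChoice_isSubZmodule of corner by <:].

Fact corner_eM (x : corner) : e * val x = val x.
Proof.
by have /eqP {1}<- := valP x; rewrite !mulrA idem_mul; exact/eqP/(valP x).
Qed.

Fact corner_Me (x : corner) : val x * e = val x.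
Proof.
by have /eqP {1}<- := valP x; rewrite -!mulrA idem_mul mulrA; exact/eqP/(valP x).
Qed.

Fact corner_one_in : e \in in_corner.
Proof. by rewrite unfold_in /in_corner !idem_mul. Qed.

Fact corner_mul_in (x y : corner) : val x * val y \in in_corner.
Proof.
by rewrite unfold_in /in_corner mulrA corner_eM -mulrA corner_Me.
Qed.

Definition corner_one : corner := exist (fun z => z \in in_corner) _ corner_one_in.
Definition corner_mul (x y : corner) : corner := exist (fun z => z \in in_corner) _ (corner_mul_in x y).

Fact corner_mulA : associative corner_mul.
Proof. by move=> x y z; apply: val_inj; rewrite /= mulrA. Qed.
Fact corner_mul1 : left_id corner_one corner_mul.
Proof. by move=> x; apply: val_inj; rewrite /= corner_eM. Qed.
Fact corner_mulr1 : right_id corner_one corner_mul.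
Proof. by move=> x; apply: val_inj; rewrite /= corner_Me. Qed.
Fact corner_mulDl : left_distributive corner_mul +%R.
Proof. by move=> x y z; apply: val_inj; rewrite /= mulrDl. Qed.
Fact corner_mulDr : right_distributive corner_mul +%R.
Proof. by move=> x y z; apply: val_inj; rewrite /= mulrDr. Qed.
HB.instance Definition _ := GRing.Zmodule_isPzRing.Build corner
  corner_mulA corner_mul1 corner_mulr1 corner_mulDl corner_mulDr.

Definition corner_topology (tau : topology R) : topology corner :=
  topology_of (initial_topology (val : corner -> topologized tau)).

Definition in_eR : {pred R} := fun x => e * x == x.

Fact in_eR_zmod : zmod_closed in_eR.
Proof.
split=> [|x y /eqP xE /eqP yE]; rewrite unfold_in /in_eR; first by rewrite mulr0.
by rewrite mulrBr xE yE.
Qed.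

HB.instance Definition _ := GRing.isZmodClosed.Build R in_eR in_eR_zmod.

Definition eR : Type := {x : R | x \in in_eR}.
HB.instance Definition _ := SubChoice.on eR.
HB.instance Definition _ := [SubChoice_isSubZmodule of eR by <:].

Fact eR_scale_in (a : R) (x : eR) : val x * a \in in_eR.
Proof. by rewrite unfold_in /in_eR mulrA; have /eqP -> := valP x. Qed.

Definition eR_scale (a : R^c) (x : eR) : eR := exist (fun z => z \in in_eR) _ (eR_scale_in a x).

Fact eR_scaleA a b x : eR_scale a (eR_scale b x) = eR_scale (a * b) x.
Proof. by apply: val_inj; rewrite /= -mulrA. Qed.
Fact eR_scale1 : left_id 1 eR_scale.
Proof. by move=> x; apply: val_inj; rewrite /= mulr1. Qed.
Fact eR_scaleDr : right_distributive eR_scale +%R.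
Proof. by move=> a x y; apply: val_inj; rewrite /= mulrDl. Qed.
Fact eR_scaleDl x : {morph eR_scale^~ x : a b / a + b}.
Proof. by move=> a b; apply: val_inj; rewrite /= mulrDr. Qed.

(* Right R-modules are left modules over the converse ring R^c. *)
HB.instance Definition _ := GRing.Zmodule_isLmodule.Build R^c eR
  eR_scaleA eR_scale1 eR_scaleDr eR_scaleDl.

End Corner.

Definition finitely_generated (A : pzRingType) (M : lmodType A) : Prop :=
  exists (n : nat) (m : 'I_n -> M), forall x : M,
    exists c : 'I_n -> A, x = \sum_(i < n) c i *: m i.

Definition projective (A : pzRingType) (M : lmodType A) : Prop :=
  forall (U V : lmodType A) (p : {linear U -> V}) (f : {linear M -> V}),
    set_surj setT setT p -> exists g : {linear M -> U}, p \o g =1 f.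

(* The functor Hom(M, -) is faithful. *)
Definition generator (A : pzRingType) (M : lmodType A) : Prop :=
  forall (U V : lmodType A) (f g : {linear U -> V}),
    (forall h : {linear M -> U}, f \o h =1 g \o h) -> f =1 g.

Definition progenerator (A : pzRingType) (M : lmodType A) : Prop :=
  [/\ finitely_generated M, projective M & generator M].

(* A^m --> A^n --> M --> 0 is exact, the first map being v |-> v *m B. *)
Definition finitely_presented (A : pzRingType) (M : lmodType A) : Prop :=
  exists (m n : nat) (B : 'M[A]_(m, n)) (p : {linear 'rV[A]_n -> M}),
    set_surj setT setT p /\ forall v, p v = 0 <-> exists u, v = u *m B.

(* The submodule M J. *)
Definition ideal_smul (A : pzRingType) (M : lmodType A) (J : set A) : set M :=
  [set x | exists (n : nat) (a : 'I_n -> A) (m : 'I_n -> M),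
     (forall i, J (a i)) /\ x = \sum_(i < n) a i *: m i].

Definition hausdorff_module (A : pzRingType) (tau : topology A)
    (M : lmodType A) : Prop :=
  \bigcap_(J in open_ideal tau) @ideal_smul A M J = [set 0].

Definition morita_preserved (P : top_property) : Prop :=
  forall (R : pzRingType) (tau : topology R),
    linear_ring_topology tau -> hausdorff_ring tau -> has_top P tau ->
    (forall n, (0 < n)%N -> has_top P (mx_topology tau n)) /\
    (forall e : idempotent_of R, progenerator (eR e : lmodType R^c) ->
       has_top P (corner_topology e tau)).

(* An S-algebra is a ring homomorphism S -> R with central image (the library's
   algType excludes the zero ring); [algebra_module phi] is R as an S-module. *)
Definition central_morphism (S : comPzRingType) (R : pzRingType)
    (phi : {rmorphism S -> R}) : Prop :=
  forall s r, phi s * r = r * phi s.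
Arguments central_morphism {S R} phi.

Definition algebra_module (S : comPzRingType) (R : pzRingType)
    (phi : {rmorphism S -> R}) : Type := R.
Arguments algebra_module {S R} phi.

Section AlgebraModule.
Variables (S : comPzRingType) (R : pzRingType) (phi : {rmorphism S -> R}).
Local Notation M := (algebra_module phi).

HB.instance Definition _ := GRing.Zmodule.copy M R.

Definition algebra_scale (s : S) (r : M) : M := phi s * (r : R).

Fact algebra_scaleA a b x :
  algebra_scale a (algebra_scale b x) = algebra_scale (a * b) x.
Proof. by rewrite /algebra_scale rmorphM mulrA. Qed.
Fact algebra_scale1 : left_id 1 algebra_scale.
Proof. by move=> x; rewrite /algebra_scale rmorph1 mul1r. Qed.
Fact algebra_scaleDr : right_distributive algebra_scale +%R.
Proof. by move=> a x y; exact: mulrDr. Qed.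
Fact algebra_scaleDl x : {morph algebra_scale^~ x : a b / a + b}.
Proof. by move=> a b; rewrite /algebra_scale rmorphD mulrDl. Qed.

HB.instance Definition _ := GRing.Zmodule_isLmodule.Build S M
  algebra_scaleA algebra_scale1 algebra_scaleDr algebra_scaleDl.

End AlgebraModule.

(* Main.v *)
(* Call a in a ring R "fitting" for a family of two-sided ideals if it splits as
   an invertible part in eRe plus a part in (1-e)R(1-e) whose powers tend to 0.
   In terms of the pair (e, b), with b the inverse of the invertible part, e and
   b are unique and commute with everything that commutes with a.

   Pro-Q implies fitting.  In every discrete ring with one of the properties Q
   all elements are fitting: for pi-regular rings this is Dischinger's theorem,
   and perfect rings are pi-regular on one side.  By uniqueness the pairs (e, b)
   are compatible along an inverse system, so they pass to the limit.

   From S to R.  Write R as the cokernel of B : S^m -> S^n and lift left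
   multiplication by a to a matrix A, so that B A = C B.  The pairs of A and C,
   which exist in the matrix rings over S by quasi-pi_inf-regularity or by Morita
   invariance, are intertwined by B because S is Hausdorff; hence they descend
   to S-linear endomorphisms of R.  These commute with right multiplications
   because R is Hausdorff, so they are left multiplications by some e and b.  As
   M_N(R) is again a finitely presented Hausdorff S-algebra, R is
   quasi-pi_inf-regular for the topology defined by the ideals JR.

   Semiperfect, semiprimary and perfect.  S decomposes 1 into finitely many
   idempotents that are local modulo topologically nilpotent elements, so R has
   finite length over S modulo the ideal generated by those.  This bounds the
   chains of idempotents of R and puts long products from Jac(R) in that ideal.

   Pro-Q for R.  A finitely generated Hausdorff module over a complete first
   countable S is complete, so R is the inverse limit of the rings R / R I_i,
   with I_i the kernels of the projections of S. *)
From HB Require Import structures.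
Require Import Defs.
From mathcomp Require Import all_boot all_algebra.
From mathcomp Require Import boolp classical_sets functions cardinality.
From mathcomp Require Import topology separation_axioms function_spaces.

Set Implicit Arguments.
Unset Strict Implicit.
Unset Printing Implicit Defensive.

Import GRing.Theory.
Local Open Scope classical_set_scope.
Local Open Scope ring_scope.

(** * Dischinger's theorem *)

(** [b] is a Drazin inverse of [a], with the vanishing of [a ^+ n * (1 - e)] relaxed to smallness
    along [F]. The family [[set [set 0]]] gives the discrete notion. *)
Definition fitting (R : pzRingType) (F : set (set R)) (a : R) : Prop :=
  exists e b : R, [/\ e * e = e, a * b = e, b * a = e, e * b = b /\ b * e = b &
    forall J, F J -> exists n, J (a ^+ n * (1 - e))].

Definition right_pi (R : pzRingType) (a : R) : Prop :=
  exists n x, a ^+ n = a ^+ n.+1 * x.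

Section Dischinger.
Variables (R : pzRingType) (rpi : forall a : R, right_pi a).

Lemma right_pi_iter (a x : R) n k :
  a ^+ n = a ^+ n.+1 * x -> a ^+ n = a ^+ (n + k) * x ^+ k.
Proof.
move=> E; elim: k => [|k ->]; first by rewrite addn0 mulr1.
have -> : a ^+ (n + k.+1) = a ^+ k * a ^+ n.+1 by rewrite -exprD addnC addSnnS.
by rewrite (exprS x) !mulrA -(mulrA _ _ x) -E -exprD addnC.
Qed.

(** Iteration gives [a ^+ k.+1 * g ^+ k = a]; where [g ^+ n = g ^+ n.+1 * y], this collapses to
    [a = a * g * y]. *)
Lemma idem_factor (a g : R) : a * a * g = a -> exists y, a = a * g * y.
Proof.
move=> aag; have [n [y E]] := rpi g; exists y.
have aS k : a ^+ k.+1 * g ^+ k = a.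
  elim: k => [|k IH]; first by rewrite mulr1.
  have -> : a ^+ k.+2 * g ^+ k.+1 = a ^+ k * (a * a * g) * g ^+ k.
    by rewrite (exprS g) !exprSr !mulrA.
  by rewrite aag -exprSr.
by rewrite -{1}(aS n) E (exprSr g) !mulrA aS.
Qed.

(* [idem_factor] is applied to the modified element g (1 - d^k h), where
   d^k = d^2k h; the new factor kills d^k from the left. *)
Lemma delta_nilpotent (a g : R) : a * a * g = a ->
  exists k, (a * g - 1) ^+ k * a = 0.
Proof.
move=> aag; set d := a * g - 1.
have ad : a * d = 0 by rewrite /d mulrBr mulr1 mulrA aag subrr.
have [n [x /(right_pi_iter n.+1) E]] := rpi d.
pose k := n.+1; pose h := x ^+ k.
have dk : d ^+ k = d ^+ k * d ^+ k * h.
  by rewrite {1}exprS E mulrA -exprS -addSn exprD.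
have adk : a * d ^+ k = 0 by rewrite exprS mulrA ad mul0r.
have [|y ->] := @idem_factor a (g * (1 - d ^+ k * h)).
  by rewrite mulrA aag mulrBr mulr1 !mulrA adk mul0r subr0.
have -> : a * (g * (1 - d ^+ k * h)) * y = (1 + d) * (1 - d ^+ k * h) * y.
  by rewrite mulrA (addrC 1 d) subrK.
exists k; have -> : d ^+ k * ((1 + d) * (1 - d ^+ k * h) * y) =
    (1 + d) * (d ^+ k - d ^+ k * d ^+ k * h) * y.
  have C : d ^+ k * (1 + d) = (1 + d) * d ^+ k.
    by rewrite mulrDr mulrDl mulr1 mul1r -exprS -exprSr.
  by rewrite !mulrA C !mulrBr !mulr1 !mulrA.
by rewrite -dk subrr mulr0 mul0r.
Qed.

(** Since [d ^+ k * a = 0] and [a * d = 0], the idempotent [e = a * g2] is a two-sided unit for [a],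
    and [c] is a right inverse of [a] in [eRe]. Right pi-regularity of [c] makes it two-sided. *)
Lemma group_inverse (a g : R) : a * a * g = a ->
  exists e c, [/\ a * c = e, c * a = e, e * e = e, e * a = a /\ a * e = a &
                  e * c = c /\ c * e = c].
Proof.
move=> aag; have [k dka] := delta_nilpotent aag; set d := a * g - 1 in dka.
have ad : a * d = 0 by rewrite /d mulrBr mulr1 mulrA aag subrr.
(* q inverts a g = 1 + d modulo a power of d. *)
pose k1 := k.+1; pose q := \sum_(i < k1) (- d) ^+ i; pose g2 := g * q.
have ag2 : a * g2 = 1 - (- d) ^+ k1.
  rewrite /g2 mulrA -[a * g](subrK 1) -/d -opprB subrX1 -mulNr opprB.
  by rewrite opprK addrC.
clearbody g2; have ea : a * g2 * a = a.
  by rewrite ag2 mulrBl mul1r exprNn -mulrA (exprS d) -(mulrA d) dka !mulr0 subr0.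
have ae : a * (a * g2) = a.
  by rewrite ag2 mulrBr mulr1 exprS mulrA mulrN ad oppr0 mul0r subr0.
have [e De] : exists e, e = a * g2 by exists (a * g2).
rewrite -De in ea ae.
have ee : e * e = e by rewrite {2}De mulrA ea -De.
pose c := e * g2 * e; exists e, c.
have ec : e * c = c by rewrite /c !mulrA ee.
have ce : c * e = c by rewrite /c -!mulrA ee.
have ac : a * c = e by rewrite /c !mulrA ae -De ee.
(* Now [c] is shown to be right invertible in the corner: [e * a ^+ n] cancels [c ^+ n], so
   [e = c * y], and a similar cancellation gives [a = e * y]. *)
clearbody c; have [n [y cn]] := rpi c.
have eanc m : e * a ^+ m * c ^+ m = e.
  elim: m => [|m IH]; first by rewrite !mulr1.
  have ean : e * a ^+ m = a ^+ m * e.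
    by apply: (@commrX _ e a m); rewrite /GRing.comm ea ae.
  have -> : e * a ^+ m.+1 * c ^+ m.+1 = e * a ^+ m * (a * c) * c ^+ m.
    by rewrite (exprSr a) (exprS c) !mulrA.
  by rewrite ac ean -(mulrA (a ^+ m)) ee -ean IH.
have cy : e = c * y.
  by rewrite -{1}(eanc n) cn exprSr !mulrA eanc ec.
have aey : a = e * y.
  have : e * a ^+ n.+1 * c ^+ n = a.
    rewrite exprS !mulrA.
    have -> : e * a * a ^+ n = a * (e * a ^+ n) by rewrite ea mulrA ae.
    by rewrite -mulrA eanc ae.
  rewrite cn.
  have -> : e * a ^+ n.+1 * (c ^+ n.+1 * y) = e * a ^+ n.+1 * c ^+ n.+1 * y.
    by rewrite mulrA.
  by rewrite eanc => ->.
split=> //.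
by rewrite aey mulrA ce -cy.
Qed.

(** The power [A = a ^+ k] has a group inverse [c]. Its idempotent commutes with [a] because it is
    both [c * A] and [A * c]. As [k = n.+1], the element [a ^+ n * c] inverts [a] on it. *)
Lemma strongly_pi (a : R) : fitting [set [set 0]] a.
Proof.
have [n [x /(right_pi_iter n.+1) E]] := rpi a; pose k := n.+1.
have Ek : a ^+ k * a ^+ k * x ^+ k = a ^+ k.
  by rewrite -exprD [(k + k)%N]addSn exprS -mulrA -E -exprS.
have [e [c [Ac cA ee [eA Ae] [ec ce]]]] := group_inverse Ek.
have [A DA] : exists A, A = a ^+ k by exists (a ^+ k).
rewrite -DA in Ek Ac cA eA Ae.
have aA : a * A = A * a by rewrite DA -exprS -exprSr.
have ea : e * a = e * a * e.
  transitivity (c * (a * A) * e); first by rewrite -!mulrA Ae aA mulrA cA.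
  by rewrite aA !mulrA cA.
have ae : a * e = e * a * e.
  transitivity (e * (A * a) * c); first by rewrite !mulrA eA -aA -mulrA Ac.
  by rewrite -aA -!mulrA Ac.
have {}ae : a * e = e * a by rewrite ae -ea.
have ca : c * a = a * c.
  transitivity (c * (A * a) * c).
    by rewrite -aA -!mulrA Ac ae mulrA ce.
  by rewrite mulrA cA -ae -mulrA ec.
have cak m : c * a ^+ m = a ^+ m * c.
  exact: (@commrX _ c a m).
exists e, (a ^+ n * c); split=> //.
- by rewrite mulrA -exprS -DA Ac.
- by rewrite -mulrA ca mulrA -exprSr -DA Ac.
- split; last by rewrite -mulrA ce.
  have -> : e * (a ^+ n * c) = a ^+ n * (e * c).
    by rewrite !mulrA (@commrX _ e a n).
  by rewrite ec.
- by move=> J ->; exists k; rewrite -DA mulrBr mulr1 Ae subrr.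
Qed.

End Dischinger.

Lemma fitting_conv (R : pzRingType) (a : R) :
  @fitting R^c [set [set 0]] a -> @fitting R [set [set 0]] a.
Proof.
move=> [e [b [ee ab ba [eb be] En]]]; exists e, b; split=> //.
have ea : (e : R) * a = a * (e : R).
  have ab' : (b : R) * a = e := ab; have ba' : a * (b : R) = e := ba.
  by rewrite -{1}ba' -mulrA ab'.
have C m : a ^+ m * (1 - (e : R)) = (1 - (e : R)) * a ^+ m.
  by rewrite mulrBr mulrBl mulr1 mul1r (@commrX _ (e : R) a m).
by move=> J /En[n]; exists n; rewrite C -revrX.
Qed.

Definition left_pi (R : pzRingType) (a : R) : Prop :=
  exists n x, a ^+ n = x * a ^+ n.+1.

Lemma strongly_pi_left (R : pzRingType) : (forall a : R, left_pi a) ->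
  forall a : R, fitting [set [set 0]] a.
Proof.
move=> lpi a; apply: fitting_conv; apply: strongly_pi => b.
by have [n [x E]] := lpi b; exists n, x; rewrite !revrX.
Qed.

(** * Quotient rings, Jacobson radical, length *)

Record ideal_of (R : pzRingType) := IdealOf {
  ideal_set : set R;
  ideal_setP : two_sided_ideal ideal_set
}.

Section QuotientRing.
Variables (R : pzRingType) (J : ideal_of R).

Definition in_ideal : {pred R} := fun x => `[< ideal_set J x >].

Fact in_ideal_zmod : zmod_closed in_ideal.
Proof.
have [[J0 JB _] _] := ideal_setP J.
split=> [|x y /asboolP Jx /asboolP Jy]; apply/asboolP => //.
exact: JB.
Qed.

HB.instance Definition _ := GRing.isZmodClosed.Build R in_ideal in_ideal_zmod.

Definition quot_ring : Type := Quotient.quot in_ideal.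
HB.instance Definition _ := GRing.Zmodule.on quot_ring.

Definition quot_class (x : R) : quot_ring := (\pi_(Quotient.quot in_ideal) x)%qT.
Definition quot_repr (q : quot_ring) : R := repr (q : Quotient.quot in_ideal).

Fact quot_reprK : cancel quot_repr quot_class.
Proof. exact: reprK. Qed.

Lemma quot_classP x y : quot_class x = quot_class y <-> ideal_set J (x - y).
Proof.
have E := Quotient.idealrBE in_ideal x y.
split=> [/eqP|Jxy]; last by apply/eqP; rewrite -E; apply/asboolP.
by rewrite -[_ == _]E => /asboolP.
Qed.

Fact quot_class_zmod : zmod_morphism quot_class.
Proof. by move=> x y; rewrite /quot_class raddfB. Qed.

Definition quot_mul (q r : quot_ring) : quot_ring :=
  quot_class (quot_repr q * quot_repr r).

Fact quot_classM x y : quot_class (x * y) = quot_mul (quot_class x) (quot_class y).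
Proof.
have [[J0 JB JM] JL] := ideal_setP J; apply/quot_classP.
have Jx : ideal_set J (x - quot_repr (quot_class x)) by apply/quot_classP; rewrite quot_reprK.
have Jy : ideal_set J (quot_repr (quot_class y) - y) by apply/quot_classP; rewrite quot_reprK.
set x' := quot_repr _ in Jx *; set y' := quot_repr _ in Jy *.
have -> : x * y - x' * y' = (x - x') * y - x' * (y' - y).
  by rewrite mulrBl mulrBr opprB addrA subrK.
by apply: JB; [exact: JM | exact: JL].
Qed.

Fact quot_mulA : associative quot_mul.
Proof.
by move=> x y z; rewrite -[x]quot_reprK -[y]quot_reprK -[z]quot_reprK -!quot_classM mulrA.
Qed.
Fact quot_mul1 : left_id (quot_class 1) quot_mul.
Proof. by move=> x; rewrite -[x]quot_reprK -quot_classM mul1r. Qed.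
Fact quot_mulr1 : right_id (quot_class 1) quot_mul.
Proof. by move=> x; rewrite -[x]quot_reprK -quot_classM mulr1. Qed.
Fact quot_classD : {morph quot_class : x y / x + y}.
Proof. by move=> x y; rewrite /quot_class raddfD. Qed.
Fact quot_mulDl : left_distributive quot_mul +%R.
Proof.
move=> x y z; rewrite -[x]quot_reprK -[y]quot_reprK -[z]quot_reprK.
by rewrite -quot_classD -!quot_classM -quot_classD mulrDl.
Qed.
Fact quot_mulDr : right_distributive quot_mul +%R.
Proof.
move=> x y z; rewrite -[x]quot_reprK -[y]quot_reprK -[z]quot_reprK.
by rewrite -quot_classD -!quot_classM -quot_classD mulrDr.
Qed.
HB.instance Definition _ := GRing.Zmodule_isPzRing.Build quot_ring
  quot_mulA quot_mul1 quot_mulr1 quot_mulDl quot_mulDr.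

HB.instance Definition _ :=
  GRing.isZmodMorphism.Build R quot_ring quot_class quot_class_zmod.
Fact quot_class_monoid : monoid_morphism quot_class.
Proof. by split=> // x y; exact: quot_classM. Qed.
HB.instance Definition _ :=
  GRing.isMonoidMorphism.Build R quot_ring quot_class quot_class_monoid.

Lemma quot_class_eq0 x : quot_class x = 0 <-> ideal_set J x.
Proof. by rewrite -{2}[x]subr0 -quot_classP raddf0. Qed.

Lemma quot_class_surj : set_surj setT setT quot_class.
Proof. by move=> q _; exists (quot_repr q) => //; rewrite quot_reprK. Qed.

End QuotientRing.

Lemma maximal_right_ideal_ex (R : pzRingType) (I : set R) :
  right_ideal I -> ~ I 1 -> exists2 M, maximal_right_ideal M & I `<=` M.
Proof.
move=> rI I1; pose P (A : set R) := A = set0 \/ [/\ right_ideal A, I `<=` A & ~ A 1].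
have [|M [PM maxM]] := @Zorn_bigcup R P.
- move=> F FP tF; have [[A [FA Ane]]|F0] := pselect (exists A, F A /\ A <> set0).
    right; have PA B x : F B -> B x -> [/\ right_ideal B, I `<=` B & ~ B 1].
      by move=> FB Bx; case: (FP B FB) => // B0; rewrite B0 in Bx.
    have [x Ax] : exists x, A x by apply/set0P/eqP.
    have [[A0 _ _] IA _] := PA A x FA Ax.
    split; [split=> [|y z [B FB By] [C FC Cz]|y a [B FB By]]| |].
    + by exists A.
    + have [[_ BB _] _ _] := PA B y FB By; have [[_ CB _] _ _] := PA C z FC Cz.
      case: (tF B C FB FC) => BC; first by exists C => //; apply: CB => //; exact: BC.
      by exists B => //; apply: BB => //; exact: BC.
    + by have [[_ _ BM] _ _] := PA B y FB By; exists B => //; exact: BM.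
    + by move=> y Iy; exists A => //; exact: IA.
    + by move=> [B FB B1]; have [_ _] := PA B 1 FB B1.
  left; rewrite -subset0 => x [A FA Ax]; apply: F0; exists A; split=> // A0.
  by rewrite A0 in Ax.
have I0 : I 0 by case: rI.
case: PM => [M0|[rM IM M1]].
  have [] := maxM I; last by right; split.
  by rewrite M0; split=> [x []|/(_ 0 I0)].
exists M => //; split=> // [MT|J rJ MJ]; first by apply: M1; rewrite MT.
have [J1|J1] := pselect (J 1).
  by right; apply/seteqP; split=> // x _; case: rJ => _ _ /(_ 1 x J1); rewrite mul1r.
have [->|MnJ] := pselect (J = M); first by left.
have [] := maxM J; last by right; split=> //; exact: subset_trans MJ.
by split=> // JM; apply: MnJ; apply/seteqP.
Qed.

(** If [1 - x * r] is not right invertible, some maximal right ideal contains it; containing [x] as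
    well, it would contain 1. Conversely, if a maximal [M] misses [x], then [M + xR = R], so [M]
    contains a right invertible [1 - x * r]. *)
Lemma JacP (R : pzRingType) (x : R) :
  Jac R x <-> forall r, exists y, (1 - x * r) * y = 1.
Proof.
split=> [Jx r|H M [rM nM maxM]].
  pose I := [set z | exists y, z = (1 - x * r) * y].
  have [[y]|I1] := pselect (I 1); first by exists y.
  have rI : right_ideal I.
    split=> [|_ _ [y ->] [z ->]|_ a [y ->]]; first by exists 0; rewrite mulr0.
      by exists (y - z); rewrite mulrBr.
    by exists (y * a); rewrite mulrA.
  have [M mM IM] := maximal_right_ideal_ex rI I1.
  have [[_ MB MM] nM _] := mM; case: nM; apply/seteqP; split=> // z _.
  have M0 : M 0 by case: mM => [[]].
  have Mxr : M (0 - x * r) by apply: MB => //; apply: MM; exact: Jx.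
  have M1 : M ((1 - x * r) - (0 - x * r)).
    by apply: MB => //; apply: IM; exists 1; rewrite mulr1.
  by rewrite -[z]mul1r; apply: MM; rewrite sub0r opprK subrK in M1.
have [M0 MB MM] := rM; have [//|Mx] := pselect (M x).
pose J := [set z | exists y r, M y /\ z = y + x * r].
have rJ : right_ideal J.
  split=> [|_ _ [y [r [My ->]]] [z [s [Mz ->]]]|_ a [y [r [My ->]]]].
  - by exists 0, 0; rewrite mulr0 addr0.
  - by exists (y - z), (r - s); rewrite mulrBr opprD addrACA; split=> //; exact: MB.
  - by exists (y * a), (r * a); rewrite mulrDl mulrA; split=> //; exact: MM.
have [|JM|JT] := maxM J rJ.
- by move=> y My; exists y, 0; rewrite mulr0 addr0.
- by case: Mx; rewrite -JM; exists 0, 1; rewrite mulr1 add0r.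
have [y [r [My E]]] : J 1 by rewrite JT.
have [z Hz] := H r; case: Mx; rewrite -[x]mul1r -Hz.
by rewrite -mulrA; apply: MM; rewrite E addrK.
Qed.

Lemma Jac_right_ideal (R : pzRingType) : right_ideal (Jac R).
Proof.
split=> [M [[]] //|x y Jx Jy M mM|x a Jx M mM]; have [[_ MB MM] _ _] := mM.
  by apply: MB; [exact: Jx | exact: Jy].
by apply: MM; exact: Jx.
Qed.

Lemma Jac_ideal (R : pzRingType) : two_sided_ideal (Jac R).
Proof.
split; first exact: Jac_right_ideal.
move=> x a /JacP Jx; apply/JacP => r; have [u E] := Jx (r * a).
(* The classical formula: [u] is a right inverse of [1 - x * (r * a)]. *)
exists (1 + a * u * x * r).
rewrite mulrDr mulr1.
have -> : (1 - a * x * r) * (a * u * x * r) = a * ((1 - x * (r * a)) * u) * x * r.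
  by rewrite !mulrBl !mulrBr !mul1r !mulrBl !mulrA.
by rewrite E mulr1 subrK.
Qed.

(** The right inverse [y] equals [1 - x * - y], so it is right invertible too, and its right inverse
    has to be [1 - x]. *)
Lemma Jac_unit (R : pzRingType) (x : R) :
  Jac R x -> exists y, (1 - x) * y = 1 /\ y * (1 - x) = 1.
Proof.
move=> Jx; have [y E] := (JacP x).1 Jx 1; rewrite mulr1 in E; exists y; split=> //.
have [z Ez] := (JacP x).1 Jx (- y).
have E' : 1 - x * - y = y by rewrite mulrN opprK -{1}E mulrBl mul1r subrK.
rewrite E' in Ez; suff -> : 1 - x = z by [].
by transitivity ((1 - x) * (y * z)); [rewrite Ez mulr1 | rewrite mulrA E mul1r].
Qed.

Lemma Jac_idem (R : pzRingType) (e : R) : e * e = e -> Jac R e -> e = 0.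
Proof.
move=> ee /Jac_unit[y [E _]].
by rewrite -[e]mulr1 -[1 in LHS]E mulrA mulrBr mulr1 ee subrr mul0r.
Qed.

(* Topological nilpotence when F is a local basis of ideals. *)
Definition topnil (R : pzRingType) (F : set (set R)) (x : R) : Prop :=
  forall J, F J -> exists n, J (x ^+ n).

Lemma ideal_addr (R : pzRingType) (J : set R) x y :
  right_ideal J -> J x -> J y -> J (x + y).
Proof.
by move=> [J0 JB _] Jx Jy; rewrite -[y]opprK; apply: (JB) => //; rewrite -sub0r; apply: JB.
Qed.

Lemma ideal_opp (R : pzRingType) (J : set R) x : right_ideal J -> J x -> J (- x).
Proof. by move=> [J0 JB _] Jx; rewrite -sub0r; exact: JB. Qed.

Lemma ideal_sum (R : pzRingType) (J : set R) (I : Type) (r : seq I) (P : pred I) (f : I -> R) :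
  right_ideal J -> (forall i, P i -> J (f i)) -> J (\sum_(i <- r | P i) f i).
Proof.
by move=> rJ H; apply: big_ind => //; [case: rJ | move=> x y; exact: ideal_addr].
Qed.

Section Fitting.
Variables (R : pzRingType) (F : set (set R)).
Hypothesis Fideal : forall J, F J -> two_sided_ideal J.
Hypothesis F0 : forall x, (forall J, F J -> J x) -> x = 0.
Hypothesis fitR : forall a, fitting F a.

Lemma fitting_comm (a b e : R) : a * b = e -> b * a = e -> e * a = a * e.
Proof. by move=> ab ba; rewrite -{1}ab -mulrA ba. Qed.

(** Modulo [J] a finite geometric sum inverts [1 - x], so the factors of [(1 - x) ^+ k * (1 - e)]
    cancel one by one. Hence [1 - e] lies in every [J], so [e = 1] and [b] is the inverse. *)
Lemma topnil_unit x : topnil F x -> exists y, (1 - x) * y = 1 /\ y * (1 - x) = 1.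
Proof.
move=> nx; have [e [b [ee ab ba _ He]]] := fitR (1 - x).
suff e1 : e = 1 by exists b; rewrite ab ba e1.
apply/esym/eqP; rewrite -subr_eq0; apply/eqP; apply: F0 => J FJ.
have [rJ JL] := Fideal FJ; have [J0 JB JM] := rJ.
have [k Hk] := He J FJ; have [n Hn] := nx J FJ.
elim: k Hk => [|k IH]; first by rewrite mul1r.
rewrite exprS -mulrA => Hk; apply: IH; move: (_ * (1 - e)) Hk => w Hk.
rewrite -[w](subrK (x ^+ n * w)); apply: ideal_addr => //; last exact: JM.
have -> : w - x ^+ n * w = (\sum_(i < n) x ^+ i) * ((1 - x) * w).
  rewrite -{1}[w]mul1r -mulrBl mulrA; congr (_ * w).
  rewrite -opprB subrX1 -mulNr opprB.
  have : GRing.comm (1 - x) (\sum_(i < n) x ^+ i); last by [].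
  apply: commr_sym; apply: commrB; first exact: commr1.
  apply: commr_sym; apply: commr_sum => i _; exact: commrX.
exact: JL.
Qed.

Lemma topnil_Jac x : (forall r, topnil F (x * r)) -> Jac R x.
Proof. by move=> nx; apply/JacP => r; have [y [E _]] := topnil_unit (nx r); exists y. Qed.

(** The idempotent of [x] itself is the lift. Indeed [x * e - e = (x * x - x) * b] is in the
    radical, and [z = x * (1 - e)] is topologically nilpotent, so [1 - z] is a unit and [z] is in
    the radical together with [z - z * z]. *)
Lemma fitting_lift : idempotents_lift_mod_Jac R.
Proof.
move=> x Jx; have [e [b [ee ab ba [eb be] He]]] := fitR x.
have ex := fitting_comm ab ba; exists e; split=> //.
have [[J0 JB JM] JL] := Jac_ideal R.
have J1 : Jac R (x * e - e).
  have -> : x * e - e = (x * x - x) * b by rewrite mulrBl -mulrA ab.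
  exact: JM.
pose z := x * (1 - e).
have zz n : z ^+ n.+1 = x ^+ n.+1 * (1 - e).
  have C : GRing.comm x (1 - e) by apply: commrB; [exact: commr1 | rewrite /GRing.comm ex].
  rewrite exprMn_comm //; congr (_ * _); elim: n => // n IH.
  by rewrite exprSr IH mulrBl mul1r mulrBr mulr1 ee subrr subr0.
have nz : topnil F z.
  move=> J FJ; have [n Hn] := He J FJ; exists n.+1; rewrite zz exprS -mulrA.
  by case: (Fideal FJ) => _; apply.
have Jz : Jac R z.
  have [y [E _]] := topnil_unit nz.
  have -> : z = (z - z * z) * y by rewrite -{1}[z]mulr1 -E mulrA mulrBr mulr1.
  apply: (JM); have -> : z - z * z = 0 - (x * x - x) * (1 - e).
    by rewrite -expr2 zz sub0r mulrBl opprB -expr2.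
  by apply: (JB) => //; exact: JM.
have -> : e - x = 0 - (x * e - e) - z.
  by rewrite /z sub0r opprB mulrBr mulr1 opprB addrA subrK.
by apply: (JB) => //; exact: JB.
Qed.

End Fitting.

(** * Length of modules over a set of operators *)

Section Length.
Variables (A : Type) (a0 : A) (M : zmodType) (act : A -> M -> M).
Hypothesis act_zmod : forall a, zmod_morphism (act a).
Hypothesis act_sub : forall a b, exists c, forall v, act a v - act b v = act c v.
Hypothesis act_act : forall a b, exists c, forall v, act a (act b v) = act c v.

Definition stable (N : set M) : Prop :=
  [/\ N 0, forall x y, N x -> N y -> N (x - y) & forall a x, N x -> N (act a x)].

Variable N0 : set M.
Hypothesis sN0 : stable N0.

(** The tails of [s] give the flag along which [act_rank] counts. The operators form a bare type
    whose maps are closed under differences and composition, so right multiplications and central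
    scalars are treated alike. *)
Fixpoint act_span (s : seq M) : set M :=
  if s is v :: s' then [set x | exists a, act_span s' (x - act a v)] else N0.

Definition act_simple (v : M) : Prop :=
  forall a, N0 (act a v) \/ exists b, N0 (act b (act a v) - v).

(* The number of factors of the flag spanned by s that N meets; when the factors
   are simple or zero this is the length of N / N0. *)
Fixpoint act_rank (N : set M) (s : seq M) : nat :=
  if s is v :: s'
  then (`[< exists x, [/\ N x, act_span s x & ~ act_span s' x] >] + act_rank N s')%N
  else 0.

Lemma act_rank_size N s : (act_rank N s <= size s)%N.
Proof. by elim: s => //= v s IH; rewrite -add1n; apply: leq_add => //; exact: leq_b1. Qed.

Lemma act_rank_mono N N' s : N `<=` N' -> (act_rank N s <= act_rank N' s)%N.
Proof.
move=> NN'; elim: s => //= v s IH; apply: leq_add => //.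
case: asboolP => // - [x [Nx Hx nx]]; case: asboolP => //; case.
by exists x; split=> //; exact: NN'.
Qed.

Lemma stableD N x y : stable N -> N x -> N y -> N (x + y).
Proof.
by move=> [N0' NB _] Nx Ny; rewrite -[y]opprK; apply: (NB) => //; rewrite -sub0r; exact: NB.
Qed.

Lemma act_span_stable s : stable (act_span s).
Proof.
elim: s => //= v s sS; have [S0 SB Sa] := sS; split=> [|x y [a Hx] [b Hy]|a x [b Hx]].
- by have [c Hc] := act_sub a0 a0; exists c; rewrite -Hc subrr subr0.
- have [c Hc] := act_sub a b; exists c.
  have -> : x - y - act c v = (x - act a v) - (y - act b v).
    by rewrite -Hc !opprB addrACA [RHS]addrACA [- y - _]addrC.
  exact: SB.
- by have [c Hc] := act_act a b; exists c; rewrite -Hc -act_zmod; exact: Sa.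
Qed.

Lemma act_span_sub v s : act_span s `<=` act_span (v :: s).
Proof.
move=> x Sx; have [c Hc] := act_sub a0 a0.
by exists c; rewrite -Hc subrr subr0.
Qed.

Lemma act_span0 s : N0 `<=` act_span s.
Proof. by elim: s => // v s IH x /IH; exact: act_span_sub. Qed.

Lemma act_rank_eq N N' s : stable N -> stable N' -> N `<=` N' -> N0 `<=` N ->
  (forall v, v \in s -> act_simple v) -> act_rank N s = act_rank N' s ->
  forall x, N' x -> act_span s x -> N x.
Proof.
move=> sN sN' NN' N0N; have [_ NB Na] := sN; have [_ NB' Na'] := sN'.
elim: s => [_ _ x _ /N0N //|v s IH simp rk x N'x].
have rk' := act_rank_mono s NN'.
have rks : act_rank N s = act_rank N' s.
  apply/eqP; rewrite eqn_leq rk' /=; move: rk => /=.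
  case: asboolP => [[y [Ny Hy nHy]]|_].
    case: asboolP => [_ /eqP|[]]; first by rewrite eqn_add2l => /eqP ->.
    by exists y; split=> //; exact: NN'.
  by case: asboolP => _; rewrite /= !add0n => ->; rewrite ?leq_addl.
have simps w : w \in s -> act_simple w by move=> ws; apply: simp; rewrite inE ws orbT.
have {}IH := IH simps rks.
have [S0 SB Sa] := act_span_stable s.
have [Sx|nSx] := pselect (act_span s x); first by move=> _; exact: IH.
move=> Hx; have [z [Nz Hz nSz]] : exists z, [/\ N z, act_span (v :: s) z & ~ act_span s z].
  apply: contrapT => nz; move: rk => /=; rewrite rks.
  case: asboolP => // _; case: asboolP => [_|[]]; last by exists x.
  by move/eqP; rewrite eqn_add2r.
case: Hx => a Hx; case: Hz => b Hz.
have [N0b|[c Hc]] := simp v (mem_head _ _) b.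
  by case: nSz; rewrite -(subrK (act b v) z); apply: stableD; [split | | exact: act_span0].
(* Modulo [N0], [c] takes [b v] back to [v], and then [a] takes it to [a v]; so [d z] and [x] have
   the same leading term. *)
have [d Hd] := act_act a c.
have Sxz : act_span s (x - act d z).
  have -> : x - act d z = (x - act a v) - act a (act c (act b v) - v) - act a (act c (z - act b v)).
    by rewrite !act_zmod !Hd !opprB !addrA !subrK.
  apply: (SB); last exact/Sa/Sa.
  by apply: (SB) => //; apply: Sa; exact: act_span0.
rewrite -(subrK (act d z) x); apply: stableD => //; last exact: Na.
by apply: IH => //; apply: NB' => //; apply: Na'; exact: NN'.
Qed.

(** Otherwise the rank, at most [size s], would drop at each of the first [size s + 1] steps. *)
Lemma descending_chain (N : nat -> set M) s :
  (forall k, stable (N k)) -> (forall k, N0 `<=` N k) ->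
  (forall k, N k.+1 `<=` N k) -> (forall v, v \in s -> act_simple v) ->
  (forall x, act_span s x) -> exists2 k, (k <= size s)%N & N k `<=` N k.+1.
Proof.
move=> sN N0N dN simp spanT; apply: contrapT => nk.
suff H k : (k <= (size s).+1)%N -> (act_rank (N k) s + k <= size s)%N.
  by have := H _ (leqnn _); rewrite addnS ltnNge leq_addl.
elim: k => [|k IH] ks; first by rewrite addn0 act_rank_size.
apply: leq_trans (IH (ltnW ks)); rewrite addnS ltn_add2r ltn_neqAle.
rewrite act_rank_mono // andbT; apply/eqP => rk; apply: nk; exists k => // x Nx.
exact: (act_rank_eq (sN _) (sN _) (dN k)) (N0N _) simp rk x Nx (spanT x).
Qed.

(** Induction on a bound for the rank: either some term has smaller rank, or the rank is constant
    from [n] on. *)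
Lemma descending_stable (N : nat -> set M) s :
  (forall k, stable (N k)) -> (forall k, N0 `<=` N k) ->
  (forall k, N k.+1 `<=` N k) -> (forall v, v \in s -> act_simple v) ->
  (forall x, act_span s x) -> exists n, forall m, (n <= m)%N -> N n `<=` N m.
Proof.
move=> sN N0N dN simp spanT.
have dNm n m : (n <= m)%N -> N m `<=` N n.
  by move=> /subnK <-; elim: (m - n)%N => // k IH x /dN /IH.
suff H r n : (act_rank (N n) s <= r)%N -> exists n, forall m, (n <= m)%N -> N n `<=` N m.
  exact: (H _ 0%N (leqnn _)).
elim: r n => [|r IH] n rk.
  exists n => m nm x Nx.
  apply: (act_rank_eq (sN m) (sN n) (dNm n m nm) (N0N m) simp _ Nx (spanT x)).
  by apply/eqP; rewrite eqn_leq act_rank_mono ?(leq_trans rk) //; exact: dNm.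
have [[m rm]|nm] := pselect (exists m, (act_rank (N m) s <= r)%N); first exact: IH rm.
exists n => m nlm x Nx.
apply: (act_rank_eq (sN m) (sN n) (dNm n m nlm) (N0N m) simp _ Nx (spanT x)).
apply/eqP; rewrite eqn_leq act_rank_mono /=; last exact: dNm.
by apply: leq_trans rk _; rewrite ltnNge; apply/negP => rm; apply: nm; exists m.
Qed.

Lemma act_span_mem a v s : v \in s -> act_span s (act a v).
Proof.
elim: s => // w s IH; rewrite inE => /predU1P[->|/IH]; last exact: act_span_sub.
by exists a; rewrite subrr; case: (act_span_stable s).
Qed.

Lemma stable_sum (N : set M) (I : Type) (r : seq I) (P : pred I) (f : I -> M) :
  stable N -> (forall i, P i -> N (f i)) -> N (\sum_(i <- r | P i) f i).
Proof.
by move=> sN H; apply: big_ind => //; [case: sN | move=> x y; exact: stableD].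
Qed.

End Length.

(** * Semiperfect rings and the discrete properties *)

(** Modulo the radical each [u] generates a simple or zero right ideal, and together these span the
    quotient. *)
Lemma semilocal_of_cover (R : pzRingType) (us : seq R) :
  \sum_(u <- us) u = 1 ->
  (forall u, u \in us -> forall c, Jac R (u * c) \/ exists c', Jac R (u * c * c' - u)) ->
  semilocal R.
Proof.
move=> us1 loc; pose K := IdealOf (Jac_ideal R); pose Q := quot_ring K.
pose p : {rmorphism R -> Q} := @quot_class R K.
have p0 x : p x = 0 <-> Jac R x by exact: quot_class_eq0.
have psurj q : exists x, p x = q by have [x _ <-] := @quot_class_surj R K q I; exists x.
have simp u : u \in us -> forall c, p u * c = 0 \/ exists c', p u * c * c' = p u.
  move=> uus c; have [x <-] := psurj c; have [/p0 E|[y /p0 E]] := loc u uus x.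
    by left; rewrite -rmorphM.
  by right; exists (p y); apply/eqP; rewrite -subr_eq0 -!rmorphM -rmorphB E.
have pus1 : \sum_(u <- us) p u = 1 by rewrite -rmorph_sum us1 rmorph1.
exists Q, p; split.
- exact: quot_class_surj.
- by apply/seteqP; split=> x /p0.
- move=> I rI; have [I0 IB IM] := rI.
  (* The complement is built greedily: [p v] is added to [J] unless the enlarged ideal meets [I]
     nontrivially, in which case simplicity already puts [p v] into [I + J]. *)
  have [J [rJ IJ HJ]] : exists J, [/\ right_ideal J, forall x, I x -> J x -> x = 0 &
      forall u, u \in us -> exists y z, [/\ I y, J z & p u = y + z]].
    elim: us simp {us1 loc pus1} => [_|v us IH simp].
      exists [set 0]; split=> //; split=> [//|x y -> ->|x a ->]; first by rewrite subrr.
      by rewrite mul0r.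
    have [J [rJ IJ HJ]] := IH (fun u uus => simp u (mem_behead (s := v :: us) uus)).
    have [J0 JB JM] := rJ.
    have [[x [Ix [[c [y [Jy xE]]] xn0]]]|no] :=
        pselect (exists x, I x /\ (exists c y, J y /\ x = y + p v * c) /\ x <> 0).
      exists J; split=> // u; rewrite inE => /predU1P[->|]; last exact: HJ.
      have [vc0|[c' vc]] := simp v (mem_head _ _) c.
        by case: xn0; apply: IJ => //; rewrite xE vc0 addr0.
      exists (x * c'), (0 - y * c'); split; [exact: IM | by apply: JB => //; exact: JM | ].
      by rewrite xE mulrDl vc sub0r addrAC subrr add0r.
    exists [set x | exists c y, J y /\ x = y + p v * c]; split.
    + split=> [|_ _ [c [y [Jy ->]]] [d [z [Jz ->]]]|_ a [c [y [Jy ->]]]].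
      - by exists 0, 0; rewrite mulr0 addr0.
      - by exists (c - d), (y - z); rewrite mulrBr opprD addrACA; split=> //; exact: JB.
      - by exists (c * a), (y * a); rewrite mulrDl mulrA; split=> //; exact: JM.
    + by move=> x Ix Hx; apply: contrapT => xn0; apply: no; exists x.
    + move=> u; rewrite inE => /predU1P[->|/HJ[y [z [Iy Jz ->]]]].
        by exists 0, (p v); rewrite add0r; split=> //; exists 1, 0; rewrite add0r mulr1.
      by exists y, z; split=> //; exists 0, z; rewrite mulr0 addr0.
  have [J0 JB JM] := rJ; exists J; split=> //.
    by apply/seteqP; split=> [x [Ix Jx]|x ->]; [exact: IJ | split].
  suff [y [z [Iy Jz E]]] : exists y z, [/\ I y, J z & 1 = y + z].
    by move=> x; exists (y * x), (z * x); split; [exact: IM | exact: JM | rewrite -mulrDl -E mul1r].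
  rewrite -pus1; move: HJ; elim: (us) => [_|v s IH HJ].
    by exists 0, 0; rewrite big_nil addr0.
  have [y [z [Iy Jz E]]] := IH (fun u us' => HJ u (mem_behead (s := v :: s) us')).
  have [y' [z' [Iy' Jz' E']]] := HJ v (mem_head _ _).
  exists (y' + y), (z' + z); split; try exact: ideal_addr.
  by rewrite big_cons E E' addrACA.
- pose act (c x : Q) := x * c; move=> I rI dI.
  have actZ a : zmod_morphism (act a) by move=> x y; rewrite /act mulrBl.
  have actB a b : exists c, forall v, act a v - act b v = act c v.
    by exists (a - b) => v; rewrite /act mulrBr.
  have actA a b : exists c, forall v, act a (act b v) = act c v.
    by exists (b * a) => v; rewrite /act mulrA.
  have s0 : stable act [set 0].
    by split=> [//|x y -> ->|a x ->]; rewrite ?subrr // /act mul0r.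
  have [|||||n Hn] := @descending_stable Q 0 Q act actZ actB actA _ s0 I [seq p u | u <- us].
  + by move=> k; have [I0 IB IM] := rI k; split=> // a x; exact: IM.
  + by move=> k x ->; case: (rI k).
  + exact: dI.
  + move=> _ /mapP[u uus ->] c; rewrite /act; have [->|[c' E]] := simp u uus c; first by left.
    by right; exists c'; rewrite /= E subrr.
  + move=> x; have -> : x = \sum_(v <- [seq p u | u <- us]) act x v.
      by rewrite big_map /act -mulr_suml pus1 mul1r.
    rewrite big_seq; apply: stable_sum; first exact: act_span_stable.
    by move=> v vus; exact: act_span_mem.
  exists n => m nm; apply/seteqP; split; last exact: Hn.
  by move: nm => /subnK <-; elim: (m - n)%N => // k IH x /dI /IH.
Qed.

(** Strictness is measured modulo [Z], the elements that count as zero: [[set 0]] or the kernel of a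
    map. *)
Definition idem_chain (R : pzRingType) (Z : set R) (s : nat -> R) : Prop :=
  forall k, [/\ s k * s k = s k, s k * s k.+1 = s k.+1, s k.+1 * s k = s k.+1 &
                ~ Z (s k - s k.+1)].

Definition prim_idem (R : pzRingType) (Z : set R) (e : R) : Prop :=
  e * e = e /\ forall f, f * f = f -> e * f = f -> f * e = f -> Z f \/ Z (e - f).

(** An idempotent without such a decomposition splits nontrivially, and one of its two summands has
    none either; starting from 1 this would give an infinite chain. *)
Lemma idem_decomp (R : pzRingType) (Z : set R) :
  (forall s, ~ idem_chain Z s) ->
  exists us, \sum_(u <- us) u = 1 /\ forall u, u \in us -> prim_idem Z u.
Proof.
move=> dcc; pose good (e : R) := exists us, \sum_(u <- us) u = e /\
  forall u, u \in us -> prim_idem Z u.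
have step (e : {e : R | e * e = e /\ ~ good e}) : exists f : {e : R | e * e = e /\ ~ good e},
    [/\ sval e * sval f = sval f, sval f * sval e = sval f & ~ Z (sval e - sval f)].
  case: e => e [ee be] /=.
  have np : ~ prim_idem Z e.
    move=> pe; apply: be; exists [:: e]; rewrite big_seq1; split=> // u.
    by rewrite inE => /eqP ->.
  have [f [ff ef fe nZ]] : exists f, [/\ f * f = f, e * f = f, f * e = f & ~ (Z f \/ Z (e - f))].
    apply: contrapT => nf; apply: np; split=> // f ff ef fe; apply: contrapT => nZ.
    by apply: nf; exists f.
  have gg : (e - f) * (e - f) = e - f by rewrite mulrBl !mulrBr ee ef fe ff subrr subr0.
  have eg : e * (e - f) = e - f by rewrite mulrBr ee ef.
  have ge : (e - f) * e = e - f by rewrite mulrBl ee fe.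
  have [gf|bf] := pselect (good f); last first.
    by exists (exist _ f (conj ff bf)); split=> // Zef; apply: nZ; right.
  have [gef|bef] := pselect (good (e - f)); last first.
    by exists (exist _ (e - f) (conj gg bef)); split=> //= Zf; apply: nZ; left; rewrite subKr in Zf.
  case: be; have [us [usE Hus]] := gf; have [vs [vsE Hvs]] := gef.
  exists (us ++ vs); rewrite big_cat /= usE vsE addrC subrK; split=> // u.
  by rewrite mem_cat => /orP[/Hus|/Hvs].
apply: contrapT => ng; have [nxt Hn] := choice step.
pose e0 : {e : R | e * e = e /\ ~ good e} := exist _ 1 (conj (mulr1 1) ng).
apply: (dcc (fun k => sval (iter k nxt e0))) => k; have [? ? ?] := Hn (iter k nxt e0).
by split=> //; case: (iter k nxt e0) => ? [].
Qed.

Section SemiperfectCriterion.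
Variables (R : pzRingType) (F : set (set R)).
Hypothesis Fideal : forall J, F J -> two_sided_ideal J.
Hypothesis F0 : forall x, (forall J, F J -> J x) -> x = 0.
Hypothesis fitR : forall a, fitting F a.

(** The idempotent of [u * c * r * u] lies below [u], so it is [u] or 0. If it is [u] for some [r],
    then [u * c] divides [u]; if it is 0 for all [r], every [u * c * r] is topologically
    nilpotent. *)
Lemma prim_idem_local u : prim_idem [set 0] u ->
  forall c, Jac R (u * c) \/ exists c', u * c * c' = u.
Proof.
move=> [uu pu] c; have [|nc] := pselect (exists c', u * c * c' = u); first by right.
left; apply: (topnil_Jac Fideal F0 fitR) => r.
have [w wE] : exists w, w = u * c * r by exists (u * c * r).
have uw : u * w = w by rewrite wE !mulrA uu.
have [e [b [ee ab ba _ He]]] := fitR (w * u).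
have ue : u * e = e by rewrite -ab !mulrA uw.
have eu : e * u = e by rewrite -ba -!mulrA uu.
have [/= e0|/= e1] := pu e ee ue eu; last first.
  case: nc; exists (r * u * b); rewrite !mulrA -wE ab.
  by move/eqP: e1; rewrite subr_eq0 => /eqP.
move=> J FJ; have [n Hn] := He J FJ; exists n.+1.
have -> : (u * c * r) ^+ n.+1 = (w * u) ^+ n * w.
  rewrite -wE; elim: n {Hn} => [|n IH]; first by rewrite mul1r.
  by rewrite exprSr IH [in RHS]exprSr -!mulrA uw.
by move: Hn; rewrite e0 subr0 mulr1; case: (Fideal FJ) => - [_ _ JM] _; exact: JM.
Qed.

Lemma semiperfect_of_chain : (forall s, ~ idem_chain [set (0 : R)] s) -> semiperfect R.
Proof.
move=> dcc; split; last exact: fitting_lift fitR.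
have [us [us1 Hus]] := idem_decomp dcc.
apply: (semilocal_of_cover us1) => u uus c.
have [|[c' E]] := prim_idem_local (Hus u uus) c; [by left | right].
by exists c'; rewrite E subrr; case: (Jac_right_ideal R).
Qed.

End SemiperfectCriterion.

(** * Fitting decompositions in rings with a discrete property *)

Lemma pi_regular_of_fitting (R : pzRingType) :
  (forall a : R, fitting [set [set 0]] a) -> pi_regular R.
Proof.
move=> fitR a; have [e [b [ee ab ba _ He]]] := fitR a.
have [n Hn] := He _ erefl; exists n => m nm.
have ane : a ^+ n * e = a ^+ n by apply/esym/eqP; rewrite -subr_eq0 -{1}[a ^+ n]mulr1 -mulrBr Hn.
have anb k : a ^+ (n + k) * b ^+ k = a ^+ n.
  elim: k => [|k IH]; first by rewrite addn0 mulr1.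
  have anke : a ^+ (n + k) * e = a ^+ (n + k) by rewrite addnC exprD -mulrA ane.
  by rewrite addnS exprSr exprS mulrA -(mulrA _ a) ab anke IH.
apply/seteqP; split=> [_ [x _ <-]|_ [x _ <-]].
  by exists (a ^+ (m - n) * x) => //; rewrite mulrA -exprD subnKC.
by exists (b ^+ (m - n) * x) => //; rewrite mulrA -{1}(subnKC nm) anb.
Qed.

Lemma right_pi_of_pi_regular (R : pzRingType) : pi_regular R -> forall a : R, right_pi a.
Proof.
move=> piR a; have [n Hn] := piR a.
have : [set a ^+ n * x | x in [set: R]] (a ^+ n * 1) by exists 1.
by rewrite mulr1 -(Hn n.+1) // => -[x _ E]; exists n, x; rewrite E.
Qed.

Lemma right_pi_of_artinian (Q : pzRingType) : right_artinian Q -> forall a : Q, right_pi a.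
Proof.
move=> artQ a; have [||n Hn] := artQ (fun k => [set a ^+ k * x | x in [set: Q]]).
- move=> k; split=> [|_ _ [x _ <-] [y _ <-]|_ c [x _ <-]].
  + by exists 0; rewrite ?mulr0.
  + by exists (x - y); rewrite ?mulrBr.
  + by exists (x * c); rewrite ?mulrA.
- by move=> k _ [x _ <-]; exists (a * x); rewrite // exprSr mulrA.
have : [set a ^+ n * x | x in [set: Q]] (a ^+ n * 1) by exists 1.
by rewrite mulr1 -(Hn n.+1) // => -[x _ E]; exists n, x; rewrite E.
Qed.

(** Dischinger's theorem applies in the artinian quotient; lifting the Drazin inverse of [p a]
    yields one [c] for both sides. *)
Lemma semilocal_pi (U : pzRingType) : semilocal U -> forall a : U,
  exists N c, Jac U (a ^+ N - a ^+ N.+1 * c) /\ Jac U (a ^+ N - c * a ^+ N.+1).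
Proof.
move=> [Q [p [psurj pker _ artQ]]] a.
have p0 x : p x = 0 -> Jac U x by move=> E; rewrite -pker.
have [e [b [ee ab ba _ He]]] := strongly_pi (right_pi_of_artinian artQ) (p a).
have [c _ cE] := psurj b I; have [N /= HN] := He _ erefl.
have aNe : p a ^+ N * e = p a ^+ N.
  by apply/esym/eqP; rewrite -subr_eq0 -{1}[p a ^+ N]mulr1 -mulrBr HN.
have eaN : e * p a ^+ N = p a ^+ N * e.
  by apply: (@commrX _ e (p a) N); exact: fitting_comm ab ba.
exists N, c; split; apply: p0; rewrite rmorphB rmorphM !rmorphXn cE.
  by rewrite exprSr -mulrA ab aNe subrr.
by rewrite exprS mulrA ba eaN aNe subrr.
Qed.

(* Nakayama's lemma for the direct limit M of U -> U -> ... along right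
   multiplication by a: M = U (1, 0) + J M, so M = U (1, 0) if J is T-nilpotent,
   and then (1, 1) in U (1, 0) reads a^k in U a^(k+1).  P y n says that y (1, n)
   is not in U (1, 0). *)
Lemma left_pi_of_Tnil (U : pzRingType) (J : set U) (a : U) N c :
  two_sided_ideal J ->
  (forall x, (forall i, J (x i)) -> exists n, right_growing_prod x n = 0) ->
  J (a ^+ N - c * a ^+ N.+1) -> left_pi a.
Proof.
move=> [rJ JL] TJ Jc; have [J0 JB JM] := rJ; apply: contrapT => npi.
pose P (y : U) n := forall k r, y * a ^+ k <> r * a ^+ (n + k).
(* In the limit [j n (1, N + n)] equals [(1, n) - c ^+ n (1, 0)], so [P] passes from [y] at [n] to
   [y * j n] at [N + n]. *)
pose j n := a ^+ N - c ^+ n * a ^+ (N + n).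
have Jj n : J (j n).
  rewrite /j; elim: n => [|n IH]; first by rewrite addn0 mul1r subrr.
  have -> : a ^+ N - c ^+ n.+1 * a ^+ (N + n.+1) =
      (a ^+ N - c ^+ n * a ^+ (N + n)) + c ^+ n * (a ^+ N - c * a ^+ N.+1) * a ^+ n.
    rewrite mulrBr mulrBl mulrA -exprSr -!mulrA -!exprD addSnnS.
    by rewrite addrA subrK.
  by apply: (ideal_addr rJ IH); apply: JM; exact: JL.
have step y n : P y n -> P (y * j n) (N + n)%N.
  move=> Py k r E; apply: (Py (N + k)%N (y * c ^+ n + r)).
  rewrite mulrDl (_ : n + (N + k) = N + n + k)%N; last by rewrite addnA (addnC n).
  rewrite -E /j mulrBr mulrBl -!mulrA -!exprD addrC.
  by rewrite subrK.
(* The indices start at 1, where [P 1 1] is the failure of left pi-regularity, and grow by [N] at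
   each step. *)
pose nn i := (i * N + 1)%N; pose x i := j (nn i).
have Px i : P (right_growing_prod x i) (nn i.+1).
  elim: i => [|i IH] /=; rewrite /nn mulSn -addnA.
    rewrite -[x 0%N]mul1r; apply: step => k r E; apply: npi; exists k, r.
    by rewrite -[LHS]mul1r E add1n.
  exact: (step _ _ IH).
have [n xn0] := TJ x (fun i => Jj _).
by apply: (Px n 0%N 0); rewrite xn0 !mul0r.
Qed.

Lemma two_sided_ideal_conv (U : pzRingType) (J : set U) :
  two_sided_ideal J -> @two_sided_ideal U^c J.
Proof.
by move=> [[J0 JB JM] JL]; split; [split=> // x a Jx; exact: JL | move=> x a Jx; exact: JM].
Qed.

Lemma right_growing_conv (U : pzRingType) (x : nat -> U) n :
  @right_growing_prod U^c x n = left_growing_prod x n.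
Proof. by elim: n => //= n ->. Qed.

Lemma right_growing_prodE (U : pzRingType) (x : nat -> U) n :
  right_growing_prod x n = \prod_(0 <= i < n.+1) x i.
Proof.
elim: n => [|n IH /=]; first by rewrite big_nat1.
by rewrite big_nat_recr //= IH.
Qed.

(** Left growing products in [U] are right growing in [U^c], so [left_pi_of_Tnil] for [U^c] gives
    right pi-regularity of [U]. *)
Lemma fitting_right_perfect (U : pzRingType) : right_perfect U ->
  forall a : U, fitting [set [set 0]] a.
Proof.
move=> [slU TU]; apply: strongly_pi => a; have [N [c [Jc _]]] := semilocal_pi slU a.
have [||n [x E]] := @left_pi_of_Tnil U^c (Jac U) a N c (two_sided_ideal_conv (Jac_ideal U)).
- move=> x /TU[n Hn]; exists n; rewrite right_growing_conv; exact: Hn.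
- by rewrite !revrX.
by exists n, x; rewrite !revrX in E.
Qed.

Lemma fitting_left_perfect (U : pzRingType) : left_perfect U ->
  forall a : U, fitting [set [set 0]] a.
Proof.
move=> [slU TU]; apply: strongly_pi_left => a; have [N [c [_ Jc]]] := semilocal_pi slU a.
apply: (left_pi_of_Tnil (Jac_ideal U) _ Jc) => x /TU[n Hn]; exists n; exact: Hn.
Qed.

Lemma left_perfect_of_semiprimary (U : pzRingType) : semiprimary U -> left_perfect U.
Proof.
move=> [slU [n Hn]]; split=> // x Jx; exists n => m nm.
rewrite right_growing_prodE (@big_cat_nat _ _ _ n) //=; last exact: leqW.
by rewrite big_mkord (Hn (fun i => x i)) ?mul0r // => i; exact: Jx.
Qed.

Lemma fitting_of_disc (Q : disc_property) (U : pzRingType) : has_disc Q U ->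
  forall a : U, fitting [set [set 0]] a.
Proof.
have piF : pi_regular U -> forall a : U, fitting [set [set 0]] a.
  by move=> piU; apply: strongly_pi; exact: right_pi_of_pi_regular.
have pi_infF : pi_inf_regular U -> forall a : U, fitting [set [set 0]] a.
  move=> /(_ 1%N isT) piU; apply: strongly_pi => a.
  have [n [X E]] := right_pi_of_pi_regular piU a%:M.
  have aX k : (a%:M : 'M[U]_1) ^+ k = (a ^+ k)%:M.
    elim: k => [|k IH]; first by [].
    by rewrite [in RHS]exprS scalar_mxM -IH; exact: exprS.
  exists n, (X 0 0); rewrite !aX in E.
  have {}E := etrans E (mul_scalar_mx _ _).
  by move/matrixP/(_ 0 0): E; rewrite !mxE eqxx mulr1n.
case: Q => /=.
- by move=> /left_perfect_of_semiprimary; exact: fitting_left_perfect.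
- exact: fitting_right_perfect.
- exact: fitting_left_perfect.
- by case=> /pi_infF.
- exact: pi_infF.
- by case=> /piF.
- exact: piF.
Qed.

(** * Module-finite algebras *)

(* The ideal of R generated by phi(J), for phi with central image. *)
Definition smulR (S R : pzRingType) (phi : S -> R) (J : set S) : set R :=
  [set x | exists2 l : seq (S * R), (forall p, p \in l -> J p.1) &
           x = \sum_(p <- l) phi p.1 * p.2].

Section SmulR.
Variables (S R : pzRingType) (phi : {rmorphism S -> R}).

Lemma smulR_mem (J : set S) s r : J s -> smulR phi J (phi s * r).
Proof.
by move=> Js; exists [:: (s, r)]; rewrite ?big_seq1 // => p; rewrite inE => /eqP ->.
Qed.

Lemma smulR_ind (J : set S) (K : set R) :
  right_ideal K -> (forall s, J s -> K (phi s)) -> smulR phi J `<=` K.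
Proof.
move=> rK JK _ [l Hl ->]; rewrite big_seq; apply: ideal_sum => // p pl.
by case: (rK) => _ _; apply; exact/JK/Hl.
Qed.

Lemma smulR_right_ideal (J : set S) : right_ideal (smulR phi J).
Proof.
have mulJ x a : smulR phi J x -> smulR phi J (x * a).
  move=> [l Hl ->]; exists [seq (p.1, p.2 * a) | p <- l].
    by move=> _ /mapP[p pl ->]; exact: (Hl p pl).
  by rewrite big_map mulr_suml; apply: eq_bigr => p _; rewrite mulrA.
split=> // [|x y Jx Jy]; first by exists [::] => [p|]; rewrite ?in_nil ?big_nil.
have {Jy} [l' Hl' yE] := mulJ y (- 1) Jy; have [l Hl ->] := Jx.
exists (l ++ l') => [p|]; first by rewrite mem_cat => /orP[/Hl|/Hl'].
by rewrite big_cat /= -yE mulrN1.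
Qed.

Lemma smulR_mono (J J' : set S) : J `<=` J' -> smulR phi J `<=` smulR phi J'.
Proof. by move=> JJ' x [l Hl ->]; exists l => // p /Hl /JJ'. Qed.

Hypothesis phi_central : forall s r, phi s * r = r * phi s.

Lemma smulR_ideal (J : set S) : two_sided_ideal (smulR phi J).
Proof.
split; first exact: smulR_right_ideal.
move=> x a [l Hl ->]; exists [seq (p.1, a * p.2) | p <- l].
  by move=> _ /mapP[p pl ->]; exact: (Hl p pl).
by rewrite big_map mulr_sumr; apply: eq_bigr => p _; rewrite mulrA -phi_central -mulrA.
Qed.

Lemma smulRM (J K L : set S) x y : (forall s t, J s -> K t -> L (s * t)) ->
  smulR phi J x -> smulR phi K y -> smulR phi L (x * y).
Proof.
move=> JKL [l Hl ->] Ky; rewrite mulr_suml big_seq.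
apply: ideal_sum; first exact: smulR_right_ideal.
move=> p /Hl Jp; rewrite -mulrA.
have : smulR phi K (p.2 * y) by case: (smulR_ideal K) => _; apply.
move=> [k Hk ->]; rewrite mulr_sumr big_seq.
apply: ideal_sum; first exact: smulR_right_ideal.
by move=> q /Hk Kq; rewrite mulrA -rmorphM; apply: smulR_mem; exact: JKL.
Qed.

End SmulR.

Lemma ideal_expB (R : pzRingType) (K : set R) (x y : R) n :
  two_sided_ideal K -> K (x - y) -> K (x ^+ n - y ^+ n).
Proof.
move=> [rK KL] Kxy; have [K0 KB KM] := rK.
elim: n => [|n IH]; first by rewrite subrr.
have -> : x ^+ n.+1 - y ^+ n.+1 = (x - y) * x ^+ n + y * (x ^+ n - y ^+ n).
  by rewrite !exprS mulrBl mulrBr addrA subrK.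
by apply: ideal_addr => //; [exact: KM | exact: KL].
Qed.

Definition prods (S : pzRingType) (N : set S) k : set S :=
  [set s | exists2 x : nat -> S, (forall i, N (x i)) & s = \prod_(0 <= i < k) x i].

Lemma prod_blocks (A : pzRingType) (x : nat -> A) m k :
  \prod_(0 <= i < m * k) x i = \prod_(0 <= j < m) \prod_(0 <= i < k) x (j * k + i)%N.
Proof.
elim: m => [|m IH]; first by rewrite !big_nil.
rewrite big_nat_recr //= -IH mulSn addnC (@big_cat_nat _ _ _ (m * k)) //= ?leq_addr //.
congr (_ * _); rewrite -{1}[(m * k)%N]add0n big_addn addKn.
by apply: eq_bigr => i _; rewrite addnC.
Qed.

Section FiniteAlgebra.
Variables (S : comPzRingType) (F : set (set S)).
Hypothesis Fideal : forall J, F J -> two_sided_ideal J.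
Variables (R : pzRingType) (phi : {rmorphism S -> R}).
Hypothesis phi_central : forall s r, phi s * r = r * phi s.
Variables (us : seq S).
Hypothesis us1 : \sum_(u <- us) u = 1.
Hypothesis us_local : forall t, t \in us -> forall s,
  topnil F (s * t) \/ exists s', phi (s' * s * t - t) = 0.
Variables (n : nat) (g : 'I_n -> R).
Hypothesis g_gen : forall x, exists c, x = \sum_(i < n) phi (c i) * g i.

Local Notation nR := (smulR phi (topnil F)).

(** Induction on the number of terms, with [K] varying. Modulo [K'], generated by [K] and the first
    scalar, the remaining sum is nilpotent; so a power of the whole sum lies in [K'], and a further
    power in [K]. *)
Lemma nilR_fnil (G : set (set R)) :
  (forall K, G K -> two_sided_ideal K) ->
  (forall K, G K -> exists2 J, F J & forall s, J s -> K (phi s)) ->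
  nR `<=` topnil G.
Proof.
move=> Gideal FG _ [l Hl ->] K GK.
have {Hl FG} : forall p, p \in l -> exists k, K (phi p.1 ^+ k).
  have [J FJ JK] := FG K GK; move=> p /Hl /(_ J FJ)[k Jk].
  by exists k; rewrite -rmorphXn; exact: JK.
have {GK} := Gideal K GK; elim: l K => [|p l IH] K iK Hl.
  by exists 1%N; rewrite big_nil; case: iK => [[]].
have [rK KL] := iK; have [K0 KB KM] := rK; rewrite big_cons; set y := \sum_(j <- l) _ in IH *.
pose K' := [set x | exists r z, K z /\ x = phi p.1 * r + z].
have iK' : two_sided_ideal K'.
  split; [split=> [|_ _ [r [z [Kz ->]]] [r' [z' [Kz' ->]]]|_ a [r [z [Kz ->]]]]|].
  - by exists 0, 0; rewrite mulr0 addr0.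
  - by exists (r - r'), (z - z'); rewrite mulrBr opprD addrACA; split=> //; exact: KB.
  - by exists (r * a), (z * a); rewrite mulrDl mulrA; split=> //; exact: KM.
  - move=> _ a [r [z [Kz ->]]]; exists (a * r), (a * z).
    by rewrite mulrDr !mulrA phi_central; split=> //; exact: KL.
have [q qL|m Hm] := IH K' iK'.
  have [k Kk] := Hl q (mem_behead (s := p :: l) qL); exists k, 0, (phi q.1 ^+ k).
  by rewrite mulr0 add0r.
have [k Kk] := Hl p (mem_head _ _).
have [r [z [Kz E]]] : K' ((phi p.1 * p.2 + y) ^+ m).
  rewrite -[X in K' X](subrK (y ^+ m)); apply: ideal_addr => //; first by case: iK'.
  by apply: ideal_expB => //; exists p.2, 0; rewrite addrK addr0.
exists (m * k)%N; rewrite exprM E.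
rewrite -[X in K X](subrK ((phi p.1 * r) ^+ k)); apply: ideal_addr => //.
  by apply: ideal_expB => //; rewrite addrC addKr.
by rewrite exprMn_comm; [exact: KM | exact: phi_central].
Qed.

Let act (s : S) (x : R) : R := phi s * x.

(** By [us_local] the elements [phi t * g i] span simple or zero [S]-modules modulo [nR], so
    [R / nR] has length at most [size us * n] over [S]. Right ideals are [S]-submodules because
    [phi] is central. *)
Lemma finite_algebra_chain (N : nat -> set R) :
  (forall k, right_ideal (N k)) -> (forall k, nR `<=` N k) ->
  (forall k, N k.+1 `<=` N k) ->
  exists2 k, (k <= size us * n)%N & N k `<=` N k.+1.
Proof.
move=> rN nN dN; have actZ a : zmod_morphism (act a) by move=> x y; rewrite /act mulrBr.
have actB a b : exists c, forall v, act a v - act b v = act c v.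
  by exists (a - b) => v; rewrite /act rmorphB mulrBl.
have actA a b : exists c, forall v, act a (act b v) = act c v.
  by exists (a * b) => v; rewrite /act mulrA rmorphM.
have st (K : set R) : right_ideal K -> stable act K.
  by move=> [K0 KB KM]; split=> // a x Kx; rewrite /act phi_central; exact: KM.
have snR : stable act nR by apply: st; exact: smulR_right_ideal.
pose s := [seq phi t * g i | t <- us, i <- enum 'I_n].
have -> : (size us * n)%N = size s by rewrite size_allpairs size_enum_ord.
apply: (descending_chain 0 actZ actB actA snR) => //.
- by move=> k; exact: st.
- move=> _ /allpairsP[[t i] /= [tus _ ->]] a; rewrite /act mulrA -rmorphM.
  have [na|[b Hb]] := us_local tus a; first by left; exact: smulR_mem.
  right; exists b; rewrite mulrA -rmorphM -mulrBl mulrA -rmorphB Hb mul0r.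
  by case: snR.
- move=> x; have [c ->] := g_gen x.
  apply: stable_sum => [|i _]; first exact: (act_span_stable 0 actZ actB actA snR).
  have -> : phi (c i) * g i = \sum_(t <- us) act (c i) (phi t * g i).
    rewrite /act -mulr_sumr -mulr_suml -rmorph_sum us1 rmorph1 mul1r //.
  rewrite big_seq; apply: stable_sum => [|t tus]; first exact: (act_span_stable 0 actZ actB actA snR).
  by apply: (act_span_mem 0 actZ actB actA snR); apply/allpairsP; exists (t, i); rewrite mem_enum.
Qed.

(** The right ideals [s k * R + nR] cannot descend strictly forever. Where two consecutive ones
    agree, the difference of the idempotents is an idempotent in [nR]; it is topologically
    nilpotent, hence zero. *)
Lemma finite_algebra_semiperfect (G : set (set R)) :
  (forall K, G K -> two_sided_ideal K) ->
  (forall x, (forall K, G K -> K x) -> x = 0) ->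
  (forall K, G K -> exists2 J, F J & forall s, J s -> K (phi s)) ->
  (forall a, fitting G a) -> semiperfect R.
Proof.
move=> Gideal G0 FG fitR; apply: (semiperfect_of_chain Gideal G0 fitR) => s sC.
have [rn nL] := smulR_ideal phi_central (topnil F); have [n0 nB nM] := rn.
have [|||k _ Nk] := @finite_algebra_chain (fun k => [set x | exists y, nR (x - s k * y)]).
- move=> k; split=> [|x x' [y Hy] [y' Hy']|x a [y Hy]].
  + by exists 0; rewrite mulr0 subrr.
  + exists (y - y'); have -> : x - x' - s k * (y - y') = (x - s k * y) - (x' - s k * y').
      by rewrite mulrBr !opprB addrACA [RHS]addrACA [- x' - _]addrC.
    exact: nB.
  + by exists (y * a); rewrite mulrA -mulrBl; exact: nM.
- by move=> k x nx; exists 0; rewrite mulr0 subr0.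
- move=> k x [y Hy]; exists (s k.+1 * y); have [_ E _ _] := sC k.
  by rewrite mulrA E.
have [ss s1 s2 nd] := sC k; have [s11 _ _ _] := sC k.+1.
have [|y Hy] := Nk (s k); first by exists 1; rewrite mulr1 subrr.
pose d := s k - s k.+1; apply: nd; rewrite /= -/d.
have dd : d * d = d by rewrite /d mulrBl !mulrBr ss s1 s2 s11 subrr subr0.
have nd : nR d.
  have -> : d = d * (s k - s k.+1 * y).
    have dk : d * s k = d by rewrite /d mulrBl ss s2.
    have dk1 : d * s k.+1 = 0 by rewrite /d mulrBl s1 s11 subrr.
    by rewrite mulrBr mulrA dk dk1 mul0r subr0.
  exact: nL.
apply: G0 => K GK; have [m Hm] := nilR_fnil Gideal FG nd GK.
have [[_ _ KM] _] := Gideal K GK; have dm : d = d ^+ m * d.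
  by rewrite -exprSr; elim: m {Hm} => // m IH; rewrite exprS -IH dd.
by rewrite dm; exact: KM.
Qed.

(* With P_k the partial products, the chain P_k R + nR stops at some k, which
   gives P_k (1 - x_k y) in nR with 1 - x_k y right invertible. *)
Lemma finite_algebra_prod (x : nat -> R) :
  (forall i y, exists z, (1 - x i * y) * z = 1) ->
  nR (\prod_(0 <= i < size us * n) x i).
Proof.
move=> xu; have [rn nL] := smulR_ideal phi_central (topnil F); have [n0 nB nM] := rn.
pose P k := \prod_(0 <= i < k) x i.
have PS k : P k.+1 = P k * x k by rewrite /P big_nat_recr.
have [|||k kD Nk] := @finite_algebra_chain (fun k => [set z | exists y, nR (z - P k * y)]).
- move=> k; split=> [|z z' [y Hy] [y' Hy']|z a [y Hy]].
  + by exists 0; rewrite mulr0 subrr.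
  + exists (y - y'); have -> : z - z' - P k * (y - y') = (z - P k * y) - (z' - P k * y').
      by rewrite mulrBr !opprB addrACA [RHS]addrACA [- z' - _]addrC.
    exact: nB.
  + by exists (y * a); rewrite mulrA -mulrBl; exact: nM.
- by move=> k z nz; exists 0; rewrite mulr0 subr0.
- by move=> k z [y Hy]; exists (x k * y); rewrite mulrA -PS.
have [|y] := Nk (P k); first by exists 1; rewrite mulr1 subrr.
rewrite PS -mulrA -{1}[P k]mulr1 -mulrBr => Pn; have [z Hz] := xu k y.
have {Pn} Pn : nR (P k) by rewrite -[P k]mulr1 -Hz mulrA; exact: nM.
by rewrite (@big_cat_nat _ _ _ k) //=; exact: nM.
Qed.

(* Koenig's lemma: if no product of the x_i vanished, expanding one factor at a
   time in terms of topologically nilpotent scalars would give a sequence of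
   scalars whose products never vanish. *)
Lemma nR_Tnil (x : nat -> R) :
  (forall s, (forall i, topnil F (s i)) -> exists k, phi (\prod_(0 <= i < k) s i) = 0) ->
  (forall i, nR (x i)) -> exists k, \prod_(0 <= i < k) x i = 0.
Proof.
move=> sT nx; apply: contrapT => nz.
pose live j (st : S * R) := forall l, (j <= l)%N -> phi st.1 * st.2 * \prod_(j <= i < l) x i <> 0.
have next (a : nat * (S * R)) : exists b : S * R, live a.1 a.2 ->
    topnil F b.1 /\ live a.1.+1 (a.2.1 * b.1, b.2).
  case: a => j [s r] /=; have [lv|] := pselect (live j (s, r)); last by exists (0, 0).
  apply: contrapT => nb.
  have : nR (r * x j) by case: (smulR_ideal phi_central (topnil F)) => _; apply.
  move=> [l Hl rE].
  (* If no term of the expansion of [r * x j] stays live, each is dead beyond some length, and all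
     are dead beyond a common [L]; this contradicts the liveness of [(s, r)]. *)
  have dead p : p \in l -> exists L, forall L', (L <= L')%N ->
      phi (s * p.1) * p.2 * \prod_(j.+1 <= i < L') x i = 0.
    move=> pl; have : ~ live j.+1 (s * p.1, p.2).
      by move=> lp; apply: nb; exists p => _; split=> //; exact: Hl.
    move=> nlp; apply: contrapT => nL; apply: nlp => L jL E; apply: nL.
    exists L => L' LL'; rewrite (@big_cat_nat _ _ _ L) //= mulrA.
    by rewrite [X in X * _]E mul0r.
  have [L HL] : exists L, forall L', (L <= L')%N -> forall p, p \in l ->
      phi (s * p.1) * p.2 * \prod_(j.+1 <= i < L') x i = 0.
    elim: l {Hl rE} dead => [|p l IH] dead; first by exists 0%N.
    have [L1 H1] := dead p (mem_head _ _).
    have [L2 H2] := IH (fun q ql => dead q (mem_behead (s := p :: l) ql)).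
    exists (maxn L1 L2) => L'; rewrite geq_max => /andP[L1' L2'] q.
    by rewrite inE => /predU1P[->|ql]; [exact: H1 | exact: H2].
  have := lv (maxn j.+1 L); rewrite leq_max leqnSn => /(_ isT); apply.
  rewrite big_ltn ?leq_max ?leqnn // mulrA -(mulrA _ r) rE mulr_sumr mulr_suml.
  rewrite big_seq big1 // => p pl.
  by rewrite mulrA -rmorphM HL // leq_maxr.
have [f Hf] := choice next.
pose st := fix st k : S * R := if k is j.+1 then
  ((st j).1 * (f (j, st j)).1, (f (j, st j)).2) else (1, 1).
have lv k : live k (st k).
  elim: k => [|k IH]; last by have [] := Hf (k, st k) IH.
  by move=> l _; rewrite rmorph1 !mul1r => E; apply: nz; exists l.
have [k Hk] := sT _ (fun i => (Hf (i, st i) (lv i)).1).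
have stE : (st k).1 = \prod_(0 <= i < k) (f (i, st i)).1.
  by elim: k {Hk} => [|k IH]; rewrite ?big_nil // big_nat_recr //= -IH.
by apply: (lv k k (leqnn k)); rewrite stE Hk !mul0r.
Qed.

Lemma nR_nilpotent (x : nat -> R) k :
  (forall i, nR (x i)) -> smulR phi (prods (topnil F) k) (\prod_(0 <= i < k) x i).
Proof.
move=> nx; elim: k => [|k IH].
  rewrite big_nil -[1]mulr1 -[X in X * _](rmorph1 phi); apply: smulR_mem.
  exists (fun=> 0); last by rewrite big_nil.
  by move=> _ J FJ; exists 1%N; case: (Fideal FJ) => [[]].
rewrite big_nat_recr //=; apply: (smulRM phi_central _ IH (nx k)) => _ t [a Na ->] Nt.
exists (fun i => if (i < k)%N then a i else t) => [i|]; first by case: ifP.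
rewrite big_nat_recr //= ltnn; congr (_ * _).
by rewrite big_nat_cond [RHS]big_nat_cond; apply: eq_bigr => i; rewrite andbT => /andP[_ ->].
Qed.

End FiniteAlgebra.

(** Chains of idempotents stop because their images generate right ideals of an artinian quotient of
    [U], and idempotents in the radical vanish. For a primitive [t], the idempotent of [s * t] lies
    below [t], so modulo the kernel of [h] it is 0 or [t]; accordingly [s * t] is topologically
    nilpotent or invertible next to [t]. *)
Lemma local_decomp (S : comPzRingType) (F : set (set S)) (U : pzRingType)
    (h : {rmorphism S -> U}) :
  (forall J, F J -> two_sided_ideal J) -> (forall a : S, fitting F a) ->
  (forall x, h x = 0 <-> forall J, F J -> J x) -> semilocal U ->
  exists us : seq S, \sum_(u <- us) u = 1 /\
    forall t, t \in us -> forall s, topnil F (s * t) \/ exists s', h (s' * s * t - t) = 0.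
Proof.
move=> Fideal fitS h0 [Q [p [_ pker _ artQ]]].
have p0 x : p x = 0 -> Jac U x by move=> E; rewrite -pker.
have [|us [us1 Hus]] := @idem_decomp S [set x | h x = 0].
  move=> s sC.
  have [||n Hn] := artQ (fun k => [set x | exists y, x = p (h (s k)) * y]).
  - move=> k; split=> [|_ _ [x ->] [y ->]|_ c [x ->]].
    + by exists 0; rewrite mulr0.
    + by exists (x - y); rewrite mulrBr.
    + by exists (x * c); rewrite mulrA.
  - move=> k _ [y ->]; exists (p (h (s k.+1)) * y); have [_ E _ _] := sC k.
    by rewrite mulrA -!rmorphM E.
  have : [set x | exists y, x = p (h (s n)) * y] (p (h (s n)) * 1) by exists 1.
  rewrite -(Hn n.+1) // => -[y]; rewrite mulr1 => E.
  have [ss s1 s2 nd] := sC n; have [s11 _ _ _] := sC n.+1.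
  apply: nd; pose d := s n - s n.+1; rewrite -/d.
  have dd : d * d = d by rewrite /d mulrBl !mulrBr ss s1 s2 s11 subrr subr0.
  apply: Jac_idem; first by rewrite -rmorphM dd.
  apply: p0; have dk : d = d * s n by rewrite /d mulrBl ss s2.
  have dk1 : d * s n.+1 = 0 by rewrite /d mulrBl s1 s11 subrr.
  by rewrite dk !rmorphM E mulrA -!rmorphM dk1 !rmorph0 mul0r.
exists us; split=> // t tus s; have [tt pt] := Hus t tus.
have [e [b [ee ab ba _ He]]] := fitS (s * t).
have te : t * e = e by rewrite -ab mulrA (mulrC s) mulrA tt.
have et : e * t = e by rewrite mulrC.
have [/h0 e0|te0] := pt e ee te et; [left | right].
  move=> J FJ; have [n Hn] := He J FJ; have [rJ JL] := Fideal J FJ; exists n.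
  rewrite -[_ ^+ n](subrK ((s * t) ^+ n * e)) -{1}[_ ^+ n]mulr1 -mulrBr.
  by apply: ideal_addr => //; apply: JL; exact: e0.
exists b; rewrite -mulrA ba; move: te0 => /= te0.
by rewrite -opprB rmorphN te0 oppr0.
Qed.

(** * Products of scalars that become nilpotent in a semilocal ring *)

Section Tnil.
Variables (S : comPzRingType) (U : pzRingType) (h : {rmorphism S -> U}).
Let NI := [set s : S | exists k, h s ^+ k = 0].
Hypothesis semilocalU : semilocal U.

(** Once the right ideals generated by the [P k] stop descending, [P n = P n.+1 * y]. Commutativity
    of [S] moves the new factor to the front; iterating, [P n] is a multiple of every power of the
    nilpotent [p (h (x n))]. *)
Lemma nil_prod_Jac (x : nat -> S) : (forall i, NI (x i)) ->
  exists k, Jac U (h (\prod_(0 <= i < k) x i)).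
Proof.
move=> nx; have [Q [p [_ pker _ artQ]]] := semilocalU.
pose P k := p (h (\prod_(0 <= i < k) x i)).
have PS k : P k.+1 = p (h (x k)) * P k.
  by rewrite /P big_nat_recr //= mulrC !rmorphM.
have PS' k : P k.+1 = P k * p (h (x k)) by rewrite /P big_nat_recr //= !rmorphM.
have [||n Hn] := artQ (fun k => [set z | exists y, z = P k * y]).
- move=> k; split=> [|_ _ [z ->] [y ->]|_ c [z ->]].
  + by exists 0; rewrite mulr0.
  + by exists (z - y); rewrite mulrBr.
  + by exists (z * c); rewrite mulrA.
- by move=> k _ [y ->]; exists (p (h (x k)) * y); rewrite PS' mulrA.
exists n; suff E : P n = 0 by rewrite -pker.
have : [set z | exists y, z = P n * y] (P n * 1) by exists 1.
rewrite -(Hn n.+1) // => -[y]; rewrite mulr1 => E.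
have Pk k : P n = p (h (x n)) ^+ k * P n * y ^+ k.
  elim: k => [|k IH]; first by rewrite mul1r mulr1.
  by rewrite {1}IH {1}E PS exprSr exprS !mulrA.
by have [k Hk] := nx n; rewrite (Pk k) -rmorphXn Hk rmorph0 !mul0r.
Qed.

(** [nil_prod_Jac] is applied to one tail after another, cutting the sequence into consecutive
    blocks. *)
Lemma nil_blocks (x : nat -> S) : (forall i, NI (x i)) ->
  exists (y : nat -> S) (idx : nat -> nat), (forall i, Jac U (h (y i))) /\
    forall m, \prod_(0 <= i < m) y i = \prod_(0 <= i < idx m) x i.
Proof.
move=> nx; have Hj j := nil_prod_Jac (fun i => nx (j + i)%N).
have [f Hf] := choice Hj.
pose idx := fix idx m := if m is k.+1 then (idx k + f (idx k))%N else 0%N.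
exists (fun k => \prod_(0 <= i < f (idx k)) x (idx k + i)%N), idx; split=> [i|m].
  exact: Hf.
elim: m => [|m IH]; first by rewrite !big_nil.
rewrite big_nat_recr //= IH [RHS](@big_cat_nat _ _ _ (idx m)) //= ?leq_addr //.
congr (_ * _); rewrite -{3}[idx m]add0n big_addn addKn.
by apply: eq_bigr => i _; rewrite addnC.
Qed.

Lemma h_growing (y : nat -> S) m :
  left_growing_prod (fun i => h (y i)) m = h (\prod_(0 <= i < m.+1) y i) /\
  right_growing_prod (fun i => h (y i)) m = h (\prod_(0 <= i < m.+1) y i).
Proof.
elim: m => [|m [IHl IHr]] /=; first by rewrite big_nat1.
by rewrite IHl IHr (big_nat_recr m.+1) //= -!rmorphM mulrC.
Qed.

Lemma perfect_nil_prod : right_perfect U \/ left_perfect U ->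
  forall x, (forall i, NI (x i)) -> exists k, h (\prod_(0 <= i < k) x i) = 0.
Proof.
move=> pU x nx; have [y [idx [Jy yx]]] := nil_blocks nx.
suff [m Hm] : exists m, h (\prod_(0 <= i < m) y i) = 0 by exists (idx m); rewrite -yx.
case: pU => -[_ /(_ _ Jy) [m Hm]]; exists m.+1.
  by have [<- _] := h_growing y m; exact: Hm.
by have [_ <-] := h_growing y m; exact: Hm.
Qed.

Lemma prodsS (N : set S) k s : prods N k.+1 s -> exists a b, [/\ N a, prods N k b & s = a * b].
Proof.
move=> [x Nx ->]; exists (x 0%N), (\prod_(0 <= i < k) x i.+1); split=> //.
  by exists (fun i => x i.+1).
by rewrite big_nat_recl.
Qed.

(* If the stable term I of the chain of right ideals generated by k-fold products
   were nonzero, I = NI . I would give a sequence t_1, t_2, ... in NI with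
   t_1 ... t_k I <> 0 for all k, against [nil_prod_Jac]. *)
Lemma nil_prods_Jac : exists k, forall s, prods NI k s -> Jac U (h s).
Proof.
have [Q [p [_ pker _ artQ]]] := semilocalU.
have p0 x : p x = 0 -> Jac U x by move=> E; rewrite -pker.
pose ph : {rmorphism S -> Q} := p \o h.
have [||n Hn] := artQ (fun k => smulR ph (prods NI k)).
- by move=> k; exact: smulR_right_ideal.
- move=> k; apply: smulR_ind; first exact: smulR_right_ideal.
  move=> _ [x Nx ->]; rewrite (big_nat_recr k) // (rmorphM ph).
  by apply: (smulR_mem ph); exists x.
exists n => s Ns; apply: p0; rewrite -[LHS]mulr1.
pose I := smulR ph (prods NI n).
have Is : I (ph s * 1) := smulR_mem ph 1 Ns.
pose live (t : S) := exists2 q, I q & ph t * q <> 0.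
have next (t : S) : exists t', live t -> NI t' /\ live (t * t').
  have [lt|] := pselect (live t); last by exists 0.
  apply: contrapT => nt; case: lt => q; rewrite /I -(Hn n.+1) // => Iq; case.
  have K0 : right_ideal [set q | ph t * q = 0].
    split=> [|x y /= Ex Ey|x a /= Ex]; first by rewrite /= mulr0.
      by rewrite mulrBr Ex Ey subrr.
    by rewrite mulrA Ex mul0r.
  apply: (smulR_ind K0) Iq => _ /prodsS[a [b [Na Nb ->]]] /=.
  apply: contrapT => tab; apply: nt; exists a => _; split=> //.
  by exists (ph b); [rewrite -[ph b]mulr1; exact: (smulR_mem ph) | rewrite rmorphM -mulrA -rmorphM].
have [f Hf] := choice next.
apply: contrapT => sn0; pose T := fix T k := if k is j.+1 then T j * f (T j) else 1.
have liveT k : live (T k).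
  elim: k => [|k IH] /=; last by have [] := Hf _ IH.
  by exists (ph s * 1) => //; rewrite rmorph1 mul1r.
have [k Jk] := nil_prod_Jac (fun i => (Hf _ (liveT i)).1).
have TE : T k = \prod_(0 <= i < k) f (T i).
  by elim: k {Jk} => [|k IH]; rewrite ?big_nil // big_nat_recr //= -IH.
have [q _] := liveT k; case; rewrite TE /=; rewrite -pker in Jk.
by rewrite Jk mul0r.
Qed.

Lemma semiprimary_nil_prod : semiprimary U -> exists k, forall s, prods NI k s -> h s = 0.
Proof.
move=> [_ [m Hm]]; have [k Hk] := nil_prods_Jac; exists (m * k)%N => _ [x Nx ->].
rewrite prod_blocks rmorph_prod big_mkord; apply: (Hm (fun j : 'I_m => h _)) => j.
by apply: Hk; exists (fun i => x (j * k + i)%N).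
Qed.

End Tnil.

Section Converse.
Variables (S : comPzRingType) (R : pzRingType) (phi : {rmorphism S -> R}).

(** Makes [R^c] an [S]-algebra, where left growing products of [R] become right growing ones. *)
Definition conv_morphism : S -> R^c := phi.

Fact conv_morphism_zmod : zmod_morphism conv_morphism.
Proof. exact: (rmorphB phi). Qed.
Fact conv_morphism_monoid : monoid_morphism conv_morphism.
Proof.
by split=> [|x y]; [exact: (rmorph1 phi) | rewrite mulrC; exact: (rmorphM phi)].
Qed.
HB.instance Definition _ :=
  GRing.isZmodMorphism.Build S R^c conv_morphism conv_morphism_zmod.
HB.instance Definition _ :=
  GRing.isMonoidMorphism.Build S R^c conv_morphism conv_morphism_monoid.

End Converse.

Lemma zero_ideal (R : pzRingType) : @two_sided_ideal R [set 0].
Proof.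
split; last by move=> x a /= ->; rewrite mulr0.
by split=> [//|x y /= -> ->|x a /= ->]; rewrite ?subrr ?mul0r.
Qed.

Lemma ker_ideal (R R' : pzRingType) (h : {rmorphism R -> R'}) :
  two_sided_ideal [set x | h x = 0].
Proof.
split; last by move=> x a /= E; rewrite rmorphM E mulr0.
split=> [|x y /= Ex Ey|x a /= E]; first exact: rmorph0.
  by rewrite rmorphB Ex Ey subrr.
by rewrite rmorphM E mul0r.
Qed.

(** Sorts the properties: those that include semilocality call for length arguments, while the two
    pure regularity properties follow from pi_inf-regularity of the algebra. *)
Lemma semilocal_of_disc (Q : disc_property) (U : pzRingType) : has_disc Q U ->
  semilocal U \/ forall R, pi_inf_regular R -> has_disc Q R.
Proof.
have pi1 (R : pzRingType) : pi_inf_regular R -> pi_regular R.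
  move=> piR; apply: pi_regular_of_fitting.
  exact: (@fitting_of_disc PiInfRegular).
case: Q => /=; try (by case=> ? ?; left); try (by case=> ? [] ? ?; left).
- by move=> _; right.
- by move=> _; right.
Qed.

(** * Inheritance of the discrete properties by finite algebras *)

Section DiscreteAlgebra.
Variables (S : comPzRingType) (R U : pzRingType) (phi : {rmorphism S -> R})
  (h : {rmorphism S -> U}) (n : nat) (g : 'I_n -> R).
Hypothesis phi_central : forall s r, phi s * r = r * phi s.
Hypothesis g_gen : forall x, exists c, x = \sum_(i < n) phi (c i) * g i.
Hypothesis ker_h : forall s, h s = 0 -> phi s = 0.
Hypothesis fitS : forall a : S, fitting [set [set s | h s = 0]] a.
Hypothesis fitR : forall a : R, fitting [set [set 0]] a.

Let F := [set [set s : S | h s = 0]].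

Let Fideal J : F J -> two_sided_ideal J.
Proof. by move=> ->; exact: ker_ideal. Qed.

Let topnilF : topnil F = [set s | exists k, h s ^+ k = 0].
Proof.
apply/seteqP; split=> s /=; first by move=> /(_ _ erefl)[k]; exists k; rewrite -rmorphXn.
by move=> [k E] J ->; exists k; rewrite /= rmorphXn.
Qed.

Let decomp : semilocal U -> exists us : seq S, \sum_(u <- us) u = 1 /\
  forall t, t \in us -> forall s, topnil F (s * t) \/ exists s', phi (s' * s * t - t) = 0.
Proof.
move=> slU; have h0 x : h x = 0 <-> forall J, F J -> J x by split=> [E J -> //|/(_ _ erefl)].
have [us [us1 Hus]] := local_decomp Fideal fitS h0 slU.
exists us; split=> // t tus s; have [|[s' E]] := Hus t tus s; first by left.
by right; exists s'; exact: ker_h.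
Qed.

Lemma discrete_algebra_semiperfect : semilocal U -> semiperfect R.
Proof.
move=> /decomp[us [us1 Hus]].
apply: (finite_algebra_semiperfect phi_central us1 Hus g_gen (G := [set [set 0]])) => //.
- by move=> K ->; exact: zero_ideal.
- by move=> x /(_ _ erefl).
- by move=> K ->; exists [set s | h s = 0].
Qed.

(** Blocks of length [D] have products in [smulR phi (topnil F)] by finite length, and [nR_Tnil]
    applies to the blocks. The hypothesis on [x] is stated by right invertibility so that it can be
    checked in [R^c] as well. *)
Lemma discrete_algebra_Tnil (x : nat -> R) : right_perfect U \/ left_perfect U ->
  (forall i y, exists z, (1 - x i * y) * z = 1) ->
  exists k, \prod_(0 <= i < k) x i = 0.
Proof.
move=> pU xu; have slU : semilocal U by case: pU => -[].
have [us [us1 Hus]] := decomp slU.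
pose D := (size us * n)%N; pose y j := \prod_(0 <= i < D) x (j * D + i)%N.
have [||k Hk] := nR_Tnil (F := F) phi_central (x := y).
- move=> s ns; have [|k /ker_h] := perfect_nil_prod (h := h) slU pU (x := s); last by exists k.
  by move=> i; move: (ns i); rewrite topnilF.
- by move=> j; apply: (finite_algebra_prod phi_central us1 Hus g_gen) => i.
by exists (k * D)%N; rewrite prod_blocks.
Qed.

Lemma discrete_algebra_nilpotent : semiprimary U ->
  exists k, forall x : nat -> R, (forall i, Jac R (x i)) -> \prod_(0 <= i < k) x i = 0.
Proof.
move=> pU; have slU : semilocal U by case: pU.
have [us [us1 Hus]] := decomp slU; have [k Hk] := semiprimary_nil_prod h slU pU.
pose D := (size us * n)%N; exists (k * D)%N => x Jx; rewrite prod_blocks.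
have ny j : smulR phi (topnil F) (\prod_(0 <= i < D) x (j * D + i)%N).
  apply: (finite_algebra_prod phi_central us1 Hus g_gen) => i y.
  exact: (JacP _).1.
have := nR_nilpotent Fideal phi_central k ny.
apply: (smulR_ind (K := [set 0])); first by case: (zero_ideal R).
by rewrite topnilF => s /Hk /ker_h.
Qed.

End DiscreteAlgebra.

Lemma right_growing_prod_eq0 (R : pzRingType) (x : nat -> R) k :
  \prod_(0 <= i < k) x i = 0 -> forall m, (k <= m)%N -> right_growing_prod x m = 0.
Proof.
move=> E m km; rewrite right_growing_prodE (@big_cat_nat _ _ _ k) //=; last exact: leqW.
by rewrite E mul0r.
Qed.

Lemma finite_algebra_disc (S : comPzRingType) (R U : pzRingType) (phi : {rmorphism S -> R})
    (h : {rmorphism S -> U}) (n : nat) (g : 'I_n -> R) :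
  (forall s r, phi s * r = r * phi s) ->
  (forall x, exists c, x = \sum_(i < n) phi (c i) * g i) ->
  (forall s, h s = 0 -> phi s = 0) ->
  (forall a : S, fitting [set [set s | h s = 0]] a) ->
  pi_inf_regular R ->
  forall Q, has_disc Q U -> has_disc Q R.
Proof.
move=> phiC g_gen ker_h fitS piR Q QU.
have fitR : forall a : R, fitting [set [set 0]] a by exact: (@fitting_of_disc PiInfRegular).
have [slU|] := semilocal_of_disc QU; last by apply.
have spR : semiperfect R := discrete_algebra_semiperfect phiC g_gen ker_h fitS fitR slU.
have slR : semilocal R by case: spR.
have rp := right_growing_prod_eq0.
case: Q QU => //= pU.
- split=> //; have [k Hk] := discrete_algebra_nilpotent phiC g_gen ker_h fitS pU.
  exists k => x Jx; pose y i := if insub i is Some j then x j else 0.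
  have := Hk y; rewrite big_mkord => <-.
    by apply: eq_bigr => i _; rewrite /y valK.
  by move=> i; rewrite /y; case: insubP => // _; case: (Jac_right_ideal R).
- split=> // x Jx.
  have [s r|y|||k Hk] := @discrete_algebra_Tnil S R^c U (conv_morphism phi) h n g
    _ _ _ fitS x (or_introl pU).
  + exact/esym/phiC.
  + have [c ->] := g_gen y; exists c; apply: eq_bigr => i _; exact: phiC.
  + exact: ker_h.
  (* A right inverse of [1 - x i * y] in [R^c] is a left inverse of [1 - y * x i] in [R]. *)
  + move=> i y; have Jy : Jac R ((y : R) * x i) by case: (Jac_ideal R) => _; apply; exact: Jx.
    by have [z [_ E]] := Jac_unit Jy; exists z.
  by exists k => m km; rewrite -right_growing_conv; exact: rp Hk _ km.
- split=> // x Jx.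
  have [|k Hk] := discrete_algebra_Tnil phiC g_gen ker_h fitS (x := x) (or_intror pU).
    by move=> i y; exact: (JacP _).1.
  by exists k => m km; exact: rp Hk _ km.
- by split=> //; apply: pi_regular_of_fitting.
- exact: pi_regular_of_fitting.
Qed.

(** * Descent of Fitting decompositions to finitely presented algebras *)

Lemma fitting_powers (R : pzRingType) (a b e : R) k :
  a * b = e -> b * a = e -> e * e = e -> e * b = b -> b * e = b ->
  a ^+ k * b ^+ k * e = e /\ e * (b ^+ k * a ^+ k) = e.
Proof.
move=> ab ba ee eb be; have ea := fitting_comm ab ba.
elim: k => [|k [IH1 IH2]]; first by rewrite !mulr1 mul1r.
split.
  have -> : a ^+ k.+1 * b ^+ k.+1 * e = a ^+ k * (a * b) * b ^+ k * e.
    by rewrite exprSr exprS !mulrA.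
  have ebk : e * b ^+ k = b ^+ k * e.
    by apply: (@commrX _ e b k); rewrite /GRing.comm eb be.
  by rewrite ab -(mulrA _ e) ebk mulrA -mulrA ee.
have -> : e * (b ^+ k.+1 * a ^+ k.+1) = e * b ^+ k * (b * a) * a ^+ k.
  by rewrite exprSr exprS !mulrA.
have eak : e * a ^+ k = a ^+ k * e by exact: (@commrX _ e a k).
by rewrite ba -!mulrA eak !mulrA -(mulrA e) IH2 ee.
Qed.

(** The point is that [eps] and [gam] commute with right multiplications, so that they are left
    multiplications by [eps 1] and [gam 1]. Values of [eps] are divisible by every [a ^+ k], whereas
    [a ^+ k] makes all [x - eps x] small uniformly in [x]. *)
Lemma fitting_of_endo (R : pzRingType) (G : set (set R)) (a : R) (eps gam : {additive R -> R}) :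
  (forall K, G K -> two_sided_ideal K) ->
  (forall x, (forall K, G K -> K x) -> x = 0) ->
  (forall x, eps (gam x) = gam x) -> (forall x, gam (eps x) = gam x) ->
  (forall x, eps (eps x) = eps x) ->
  (forall x, a * gam x = eps x) -> (forall x, gam (a * x) = eps x) ->
  (forall K x, G K -> K x -> K (gam x)) ->
  (forall K, G K -> exists k, forall x, K (a ^+ k * (x - eps x))) ->
  fitting G a.
Proof.
move=> Gideal G0 eg ge eeE ag ga Gg Gk.
have ea x : eps (a * x) = a * eps x by rewrite -ag ga.
have eak k x : eps (a ^+ k * x) = a ^+ k * eps x.
  by elim: k x => [|k IH] x; rewrite ?mul1r // exprSr -mulrA IH ea mulrA.
have ak k x : a ^+ k * iter k gam (eps x) = eps x.
  elim: k => [|k IH]; first by rewrite mul1r.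
  have epsi j : eps (iter j gam (eps x)) = iter j gam (eps x) by case: j => [|j] /=.
  by rewrite exprSr -mulrA /= ag epsi IH.
have gk k x : eps (iter k gam (a ^+ k * x)) = eps x.
  elim: k x => [|k IH] x; first by rewrite mul1r.
  by rewrite iterSr exprS -mulrA ga eak IH eeE.
(* Writing [eps x] as [a ^+ k * w], the error is, up to sign, [a ^+ k] times
   [w * r - eps (w * r)]. *)
have e1 x r : eps (eps x * r) = eps x * r.
  apply/eqP; rewrite -subr_eq0 -opprB oppr_eq0; apply/eqP; apply: G0 => K GK.
  have [k Hk] := Gk K GK; rewrite -(ak k x) -mulrA eak -mulrBr; exact: Hk.
(* [a ^+ k] times the argument lies in [K], and [eps] of the argument is recovered from it by
   iterating [gam], which preserves [K]. *)
have e2 x r : eps ((x - eps x) * r) = 0.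
  apply: G0 => K GK; have [k Hk] := Gk K GK; have [[K0 KB KM] KL] := Gideal K GK.
  have gi j y : K y -> K (iter j gam y) by move=> Ky; elim: j => //= j IH; exact: Gg.
  rewrite -(gk k) -ag; apply: KL; apply: Gg => //; apply: gi.
  by rewrite mulrA; apply: KM; exact: Hk.
have eM x r : eps (x * r) = eps x * r.
  by rewrite -{1}[x](subrK (eps x)) mulrDl raddfD e2 add0r e1.
have gM x r : gam (x * r) = gam x * r.
  by rewrite -ge eM -ag -mulrA ga eM eg.
exists (eps 1), (gam 1); split; rewrite ?ag -?eM -?gM ?mul1r ?eeE ?eg ?ge //.
  by rewrite -{1}[a]mulr1 ga.
by move=> K GK; have [k Hk] := Gk K GK; exists k.
Qed.

Lemma mul_in_ideal (S : pzRingType) (J : set S) k l q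
    (X : 'M[S]_(k, l)) (Y : 'M[S]_(l, q)) :
  two_sided_ideal J -> (forall i j, J (X i j)) \/ (forall i j, J (Y i j)) ->
  forall i j, J ((X *m Y) i j).
Proof.
move=> [rJ JL] H i j; rewrite mxE; apply: ideal_sum => // t _.
by case: H => H; [case: rJ => _ _; apply | apply: JL].
Qed.

Section FinitelyPresentedAlgebra.
Variables (S : comPzRingType) (F : set (set S)).
Hypothesis Fideal : forall J, F J -> two_sided_ideal J.
Hypothesis F0 : forall x, (forall J, F J -> J x) -> x = 0.
Hypothesis fitM : forall k (A : 'M[S]_k), fitting [set @mx_over S k J | J in F] A.
Variables (R : pzRingType) (phi : {rmorphism S -> R}).
Hypothesis phi_central : forall s r, phi s * r = r * phi s.
Hypothesis R0 : forall x, (forall J, F J -> smulR phi J x) -> x = 0.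
Variables (m n : nat) (B : 'M[S]_(m, n)) (p : {linear 'rV[S]_n -> algebra_module phi}).
Hypothesis p_surj : forall x, exists v, p v = x.
Hypothesis p_ker : forall v, p v = 0 <-> exists u, v = u *m B.

Lemma presentation_gen v : p v = \sum_(i < n) phi (v 0 i) * p (delta_mx 0 i).
Proof. by rewrite {1}[v]row_sum_delta linear_sum; apply: eq_bigr => i _; rewrite linearZ. Qed.

Lemma presentation_ideal (J : set S) (v : 'rV[S]_n) : (forall i, J (v 0 i)) -> smulR phi J (p v).
Proof.
move=> Jv; rewrite presentation_gen; apply: ideal_sum; first exact: smulR_right_ideal.
by move=> i _; exact: smulR_mem.
Qed.

(* Both E' B (1 - E) = E' G'^k B A^k (1 - E) and
   (1 - E') B E = C^k (1 - E') B G^k E are arbitrarily small. *)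
Lemma fitting_intertwine (A : 'M[S]_n) (C : 'M[S]_m) E G E' G' :
  B *m A = C *m B ->
  A *m G = E -> G *m A = E -> E *m E = E -> E *m G = G -> G *m E = G ->
  (forall J, F J -> exists k, mx_over J (A ^+ k *m (1%:M - E))) ->
  C *m G' = E' -> G' *m C = E' -> E' *m E' = E' -> E' *m G' = G' -> G' *m E' = G' ->
  (forall J, F J -> exists k, mx_over J (C ^+ k *m (1%:M - E'))) ->
  B *m E = E' *m B /\ B *m G = G' *m B.
Proof.
move=> BA AG GA EE EG GE HA CG GC EE' EG' GE' HC.
have BAk k : B *m A ^+ k = C ^+ k *m B.
  elim: k => [|k IH]; first by rewrite !expr0 mulmx1 mul1mx.
  have AS : A ^+ k.+1 = A ^+ k *m A by exact: exprSr.
  have CS : C ^+ k.+1 = C ^+ k *m C by exact: exprSr.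
  by rewrite AS CS mulmxA IH -!mulmxA BA.
have z1 : E' *m B *m (1%:M - E) = 0.
  apply/matrixP => i j; rewrite [RHS]mxE; apply: F0 => J FJ; have [k Hk] := HA J FJ.
  have [_ E'k] := @fitting_powers _ C G' E' k CG GC EE' EG' GE'.
  have -> : E' *m B *m (1%:M - E) = E' *m G' ^+ k *m B *m (A ^+ k *m (1%:M - E)).
    rewrite !mulmxA -(mulmxA _ B (A ^+ k)) BAk mulmxA.
    by congr (_ *m B *m _); rewrite -mulmxA; exact/esym/E'k.
  by apply: mul_in_ideal; [exact: Fideal | right].
have z2 : (1%:M - E') *m B *m E = 0.
  apply/matrixP => i j; rewrite [RHS]mxE; apply: F0 => J FJ; have [k Hk] := HC J FJ.
  have [Ek _] := @fitting_powers _ A G E k AG GA EE EG GE.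
  have -> : (1%:M - E') *m B *m E = C ^+ k *m (1%:M - E') *m (B *m G ^+ k *m E).
    have -> : C ^+ k *m (1%:M - E') = (1%:M - E') *m C ^+ k.
      apply/esym; apply: (@commrX _ (1 - E') C k); apply: commr_sym; apply: commrB; first exact: commr1.
      by apply: commr_sym; exact: fitting_comm CG GC.
    rewrite !mulmxA -(mulmxA _ (C ^+ k) B) -BAk !mulmxA -!mulmxA.
    by congr (_ *m (_ *m _)); rewrite mulmxA; exact/esym/Ek.
  by apply: mul_in_ideal; [exact: Fideal | left].
have BE : B *m E = E' *m B.
  have {}z1 : E' *m B = E' *m B *m E.
    by apply/eqP; rewrite -subr_eq0 -{1}[E' *m B]mulmx1 -mulmxBr z1.
  rewrite z1; apply/eqP; rewrite -subr_eq0 -{1}[B]mul1mx -mulmxA -!mulmxA -mulmxBl mulmxA.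
  by rewrite z2.
split=> //.
by rewrite -{1}EG mulmxA BE -GC -!mulmxA (mulmxA C) -BA -mulmxA AG BE mulmxA GE'.
Qed.

Lemma fitting_algebra (a : R) : fitting [set smulR phi J | J in F] a.
Proof.
have [lift liftK] := choice p_surj.
pose A := \matrix_(i < n) lift (a * (p (delta_mx 0 i) : R)).
have pA v : p (v *m A) = a * (p v : R) :> R.
  rewrite [v in RHS]row_sum_delta linear_sum mulr_sumr mulmx_sum_row linear_sum.
  apply: eq_bigr => i _; rewrite !linearZ rowK liftK /=.
  by rewrite /GRing.scale /= /algebra_scale !mulrA phi_central.
have rowB i : exists u, row i B *m A = u *m B.
  apply/p_ker; rewrite pA; have -> : p (row i B) = 0; last exact: mulr0.
  by apply/p_ker; exists (delta_mx 0 i); rewrite rowE.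
have [c Hc] := choice rowB; pose C := \matrix_(i < m) c i.
have BA : B *m A = C *m B.
  by apply/row_matrixP => i; rewrite !row_mul Hc rowK.
have [E [G [EE AG GA [EG GE] HA]]] := fitM A.
have [E' [G' [EE' CG GC [EG' GE'] HC]]] := fitM C.
have [mEE mEG mGE] : [/\ E *m E = E, E *m G = G & G *m E = G] by [].
have [mAG mGA] : A *m G = E /\ G *m A = E by [].
have HA' J : F J -> exists k, mx_over J (A ^+ k *m (1%:M - E)).
  by move=> FJ; apply: HA; exists J.
have HC' J : F J -> exists k, mx_over J (C ^+ k *m (1%:M - E')).
  by move=> FJ; apply: HC; exists J.
have [BE BG] := fitting_intertwine BA AG GA EE EG GE HA' CG GC EE' EG' GE' HC'.
(* Independence of the lift, and with it additivity, holds once [X] preserves the relations; [BE]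
   and [BG] provide this for [E] and [G]. *)
pose bar (X : 'M[S]_n) (x : R) : R := p (lift x *m X).
have barP X X' v : B *m X = X' *m B -> bar X (p v) = p (v *m X).
  move=> BX; apply/eqP; rewrite -subr_eq0 -raddfB -mulmxBl; apply/eqP/p_ker.
  have [u ->] : exists u, lift (p v) - v = u *m B by apply/p_ker; rewrite raddfB /= liftK subrr.
  by exists (u *m X'); rewrite -!mulmxA BX.
have barB X X' : B *m X = X' *m B -> zmod_morphism (bar X).
  move=> BX x y; rewrite -(liftK x) -(liftK y) -[_ - _](raddfB p) !(barP _ _ _ BX).
  by rewrite mulmxBl raddfB.
pose eps : {additive R -> R} :=
  HB.pack (bar E) (GRing.isZmodMorphism.Build R R (bar E) (barB _ _ BE)).
pose gam : {additive R -> R} :=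
  HB.pack (bar G) (GRing.isZmodMorphism.Build R R (bar G) (barB _ _ BG)).
have epsP v : eps (p v) = p (v *m E) by exact: barP BE.
have gamP v : gam (p v) = p (v *m G) by exact: barP BG.
apply: (fitting_of_endo (eps := eps) (gam := gam)).
- by move=> _ [J FJ <-]; exact: smulR_ideal.
- by move=> x Hx; apply: R0 => J FJ; apply: Hx; exists J.
- by move=> x; rewrite -(liftK x) gamP epsP -mulmxA mGE.
- by move=> x; rewrite -(liftK x) epsP !gamP -mulmxA mEG.
- by move=> x; rewrite -(liftK x) !epsP -mulmxA mEE.
- by move=> x; rewrite -(liftK x) gamP epsP -pA -mulmxA mGA.
- by move=> x; rewrite -(liftK x) -pA gamP epsP -mulmxA mAG.
- move=> _ _ [J FJ <-] [l Hl ->]; rewrite raddf_sum big_seq.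
  apply: ideal_sum => [|q /Hl Jq]; first exact: smulR_right_ideal.
  have -> : phi q.1 * q.2 = p (q.1 *: lift q.2) by rewrite linearZ /= liftK.
  by rewrite gamP -scalemxAl linearZ; exact: smulR_mem.
- move=> _ [J FJ <-]; have [k Hk] := HA' J FJ; exists k => x.
  rewrite -(liftK x) epsP -[_ - _](raddfB p) -{1}[lift x]mulmx1 -mulmxBr.
  have -> w : a ^+ k * (p w : R) = p (w *m A ^+ k).
    elim: k {Hk} w => [|k IH] w; first by rewrite mul1r expr0 mulmx1.
    have -> : A ^+ k.+1 = A *m A ^+ k by exact: exprS.
    by rewrite exprSr -mulrA -pA IH -mulmxA.
  have C1 : (1%:M - E) *m A ^+ k = A ^+ k *m (1%:M - E).
    apply: (@commrX _ (1 - E) A k); apply: commr_sym; apply: commrB; first exact: commr1.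
    by apply: commr_sym; exact: fitting_comm AG GA.
  rewrite -mulmxA C1; apply: presentation_ideal.
  by apply: mul_in_ideal; [exact: Fideal | right].
Qed.

End FinitelyPresentedAlgebra.

Lemma fitting_mono (R : pzRingType) (G G' : set (set R)) (a : R) :
  (forall K', G' K' -> exists2 K, G K & K `<=` K') -> fitting G a -> fitting G' a.
Proof.
move=> GG' [e [b [ee ab ba eb He]]]; exists e, b; split=> // K' /GG'[K GK KK'].
by have [n Hn] := He K GK; exists n; exact: KK'.
Qed.

Lemma mx_over_ideal (R : pzRingType) n (J : set R) :
  two_sided_ideal J -> two_sided_ideal (@mx_over R n J).
Proof.
move=> iJ; have [[J0 JB JM] JL] := iJ; split; [split|].
- by move=> i j; rewrite mxE.
- by move=> X Y JX JY i j; rewrite !mxE; apply: JB; [exact: JX | exact: JY].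
- by move=> X Y JX; apply: mul_in_ideal => //; left.
- by move=> X Y JX; apply: mul_in_ideal => //; right.
Qed.

(** * Matrix rings over an algebra as finitely presented algebras *)

Section MatrixAlgebra.
Variables (S : comPzRingType) (R : pzRingType) (phi : {rmorphism S -> R}).
Hypothesis phi_central : forall s r, phi s * r = r * phi s.
Variable N : nat.

Definition mx_morphism (s : S) : 'M[R]_N := (phi s)%:M.

Fact mx_morphism_zmod : zmod_morphism mx_morphism.
Proof. by move=> x y; rewrite /mx_morphism rmorphB raddfB. Qed.
Fact mx_morphism_monoid : monoid_morphism mx_morphism.
Proof.
by split=> [|x y]; rewrite /mx_morphism ?rmorph1 // rmorphM scalar_mxM.
Qed.
HB.instance Definition _ := GRing.isZmodMorphism.Build S 'M[R]_N mx_morphism mx_morphism_zmod.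
HB.instance Definition _ := GRing.isMonoidMorphism.Build S 'M[R]_N mx_morphism mx_morphism_monoid.

Lemma mx_morphism_central s (X : 'M[R]_N) : mx_morphism s * X = X * mx_morphism s.
Proof.
have -> : mx_morphism s * X = phi s *: X by exact: mul_scalar_mx.
apply/matrixP => i j; rewrite !mxE (bigD1 j) //= big1 => [|k kj]; rewrite !mxE.
  by rewrite addr0 eqxx mulr1n phi_central.
by rewrite (negPf kj) mulr0n mulr0.
Qed.

Lemma smulR_mx (J : set S) : smulR mx_morphism J `<=` @mx_over R N (smulR phi J).
Proof.
have iJ := smulR_ideal phi_central J.
apply: smulR_ind; first by case: (mx_over_ideal N iJ).
move=> s Js i j; rewrite mxE; case: eqP => _; last by case: iJ => [[]].
by rewrite mulr1n -[phi s]mulr1; exact: smulR_mem.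
Qed.

Variables (m n : nat) (B : 'M[S]_(m, n)) (p : {linear 'rV[S]_n -> algebra_module phi}).
Hypothesis p_surj : forall x, exists v, p v = x.
Hypothesis p_ker : forall v, p v = 0 <-> exists u, v = u *m B.

(** A direct sum of [N * N] copies of [p]: [vec_mx] cuts the long row into one row per matrix entry,
    and the relation matrix becomes [lin_mulmxr B]. *)
Definition mx_presentation (v : 'rV[S]_(N * N * n)) : algebra_module mx_morphism :=
  \matrix_(i < N, j < N) (p (row (mxvec_index i j) (vec_mx v)) : R).

Fact mx_presentation_zmod : zmod_morphism mx_presentation.
Proof. by move=> u v; apply/matrixP => i j; rewrite !mxE !raddfB. Qed.
Fact mx_presentation_scalable : scalable mx_presentation.
Proof.
move=> s v; apply: etrans (esym (mul_scalar_mx _ _)).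
by apply/matrixP => i j; rewrite !mxE !linearZ.
Qed.
HB.instance Definition _ := GRing.isZmodMorphism.Build _ _ mx_presentation mx_presentation_zmod.
HB.instance Definition _ := GRing.isScalable.Build _ _ _ _ mx_presentation mx_presentation_scalable.

Lemma mx_presentation_surj x : exists v, mx_presentation v = x.
Proof.
have [lift liftK] := choice p_surj; pose X : 'M[R]_N := x.
pose V := \matrix_(k < N * N) lift (mxvec X 0 k).
exists (mxvec V); apply/matrixP => i j.
by rewrite mxE mxvecK rowK liftK mxvecE.
Qed.

Lemma mx_presentation_ker v :
  mx_presentation v = 0 <-> exists u, v = u *m lin_mulmxr B.
Proof.
split=> [v0|[u ->]].
  have rows k : exists u, row k (vec_mx v) = u *m B.
    apply/p_ker; case/mxvec_indexP: k => i j.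
    by have /matrixP/(_ i j) := v0; rewrite !mxE.
  have [c Hc] := choice rows; exists (mxvec (\matrix_k c k)).
  rewrite mul_vec_lin /= -[v in LHS]vec_mxK; congr mxvec.
  by apply/row_matrixP => k; rewrite row_mul rowK Hc.
apply/matrixP => i j; rewrite mxE [RHS]mxE; apply/p_ker.
exists (row (mxvec_index i j) (vec_mx u)).
by rewrite -{1}[u]vec_mxK mul_vec_lin mxvecK row_mul.
Qed.

End MatrixAlgebra.

Lemma fitting_matrix_algebra (S : comPzRingType) (F : set (set S)) (R : pzRingType)
    (phi : {rmorphism S -> R}) :
  (forall J, F J -> two_sided_ideal J) ->
  (forall x, (forall J, F J -> J x) -> x = 0) ->
  (forall k (A : 'M[S]_k), fitting [set @mx_over S k J | J in F] A) ->
  (forall s r, phi s * r = r * phi s) ->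
  (forall x, (forall J, F J -> smulR phi J x) -> x = 0) ->
  finitely_presented (algebra_module phi) ->
  forall N (A : 'M[R]_N), fitting [set @mx_over R N (smulR phi J) | J in F] A.
Proof.
move=> Fideal F0 fitM phiC R0 [m [n [B [p [psurj pker]]]]] N A.
have p_surj x : exists v, p v = x by have [v _ <-] := psurj x I; exists v.
pose phiN : {rmorphism S -> 'M[R]_N} := mx_morphism phi N.
have RN0 X : (forall J, F J -> smulR phiN J X) -> X = 0.
  move=> HX; apply/matrixP => i j; rewrite mxE; apply: R0 => J FJ.
  exact: (smulR_mx phiC (HX J FJ)).
have fitN := fitting_algebra Fideal F0 fitM (phi := phiN) (mx_morphism_central phiC (N := N))
  RN0 (mx_presentation_surj (N := N) p_surj) (mx_presentation_ker (N := N) pker) A.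
apply: fitting_mono fitN => _ [J FJ <-].
by exists (smulR phiN J); [exists J | exact: smulR_mx].
Qed.

(** * Linear topologies and inverse limits *)

(** A basis ideal is only assumed to be a neighbourhood of 0; continuity of addition makes it open,
    since [y] close to [x] has [y - x] in [J]. *)
Lemma open_idealP (R : pzRingType) (tau : topology R) (U : set R) :
  linear_ring_topology tau -> nbhs (0 : topologized tau) U ->
  exists2 J, open_ideal tau J & J `<=` U.
Proof.
move=> [[addC oppC _] [B [Bnbhs Bsub] Bideal]] /Bsub[J BJ JU]; exists J => //.
split; first exact: Bideal.
suff : open (J : set (topologized tau)) by [].
have [[J0 JB _] _] := Bideal J BJ.
rewrite openE => x Jx; rewrite /interior.
have nJ : nbhs ((x : R) - (x : R) : topologized tau) J by rewrite subrr; exact: Bnbhs.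
have [[P Q] /= [nP nQ] PQ] := addC (x, - (x : R)) J nJ.
apply: filterS nP => y Py.
have Jyx : J ((y : R) - (x : R)) by apply: (PQ (y, - (x : R))); split=> //; exact: nbhs_singleton.
by rewrite -(subrK (x : R) y); apply: (ideal_addr (J := J)) => //; case: (Bideal J BJ).
Qed.

Lemma hausdorff_open_ideal (R : pzRingType) (tau : topology R) :
  linear_ring_topology tau -> hausdorff_ring tau ->
  forall x, (forall J, open_ideal tau J -> J x) -> x = 0.
Proof.
move=> ltau htau x Hx; have {}htau : hausdorff_space (topologized tau) := htau.
apply: (htau (x : topologized tau) 0) => A C Ax C0.
have [J oJ JC] := open_idealP ltau C0.
by exists x; split; [exact: (nbhs_singleton Ax) | apply: JC; exact: (Hx J oJ)].
Qed.

Lemma fitting_of_quasi (R : pzRingType) (tau : topology R) (G : set (set R)) :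
  (forall K, G K -> nbhs (0 : topologized tau) K) -> quasi_pi_regular tau ->
  forall a, fitting G a.
Proof.
move=> Gn [_ _ qpi] a; have [e [ee aE [b [bE ab ba]] cv]] := qpi a.
set f := 1 - e in aE cv.
have ef : e * f = 0 by rewrite /f mulrBr mulr1 ee subrr.
have fe : f * e = 0 by rewrite /f mulrBl mul1r ee subrr.
have ff : f * f = f by rewrite {1}/f mulrBl mul1r ef subr0.
have eb : e * b = b by rewrite bE !mulrA ee.
have be : b * e = b by rewrite bE -!mulrA ee.
have aef : a * f = f * a * f.
  by rewrite {1}aE mulrDl -!mulrA ef ff !mulr0 add0r.
have afe : f * a = f * a * f.
  by rewrite {1}aE mulrDr !mulrA fe ff !mul0r add0r.
have aee : a * e = e * a * e.
  by rewrite {1}aE mulrDl -!mulrA fe ee !mulr0 addr0.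
have eae : e * a = e * a * e.
  by rewrite {1}aE mulrDr !mulrA ef ee !mul0r addr0.
exists e, b; split=> //.
- by rewrite -{1}eb mulrA aee ab.
- by rewrite -{1}be -mulrA eae ba.
(* The exponent is kept positive, since [(f * a * f) ^+ 0] is 1 rather than [f]. *)
move=> K GK; have [n _ Hn] := cv _ (Gn K GK); exists n.+1.
have fan k : (f * a * f) ^+ k.+1 = a ^+ k.+1 * f.
  elim: k => [|k IH]; first by rewrite !expr1.
  have fa : f * a ^+ k.+1 = a ^+ k.+1 * f.
    by apply: (@commrX _ f a); exact: etrans afe (esym aef).
  by rewrite exprS IH -aef -mulrA (mulrA f) fa -(mulrA _ f) ff mulrA -exprS.
by have := Hn n.+1 (leqnSn n); rewrite /= fan.
Qed.

(** A common interface to the matrix, inverse limit and algebra topologies: each is the linear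
    topology with local basis [G]. *)
Definition ideal_based (R : pzRingType) (tau : topology R) (G : set (set R)) : Prop :=
  [/\ forall K, G K -> two_sided_ideal K, exists K, G K,
      forall K L, G K -> G L -> exists M, [/\ G M, M `<=` K & M `<=` L] &
      forall U, is_open tau U <-> forall x, U x -> exists2 K, G K & forall y, K y -> U (x + y)].

Section IdealBased.
Variables (R : pzRingType) (tau : topology R) (G : set (set R)).
Hypothesis Gtau : ideal_based tau G.
Local Notation T := (topologized tau).

Lemma ideal_based_nbhs (x : R) (U : set R) :
  nbhs (x : T) U <-> exists2 K, G K & forall y, K y -> U (x + y).
Proof.
have [Gi _ _ Go] := Gtau; split.
  rewrite nbhsE => -[V [oV Vx] VU]; have [K GK KV] := (Go V).1 oV x Vx.
  by exists K => // y /KV /VU.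
move=> [K GK KU]; rewrite nbhsE; have [[K0 KB _] _] := Gi K GK.
exists [set z | K (z - x)] => [|z /= Kz]; last by rewrite -(subrK x z) addrC; exact: KU.
split; last by rewrite /= subrr.
apply/Go => z /= Kzx; exists K => // y Ky.
by rewrite /= addrAC; apply: ideal_addr => //; split=> //; case: (Gi K GK) => [[]].
Qed.

Lemma ideal_based_open_ideal K : G K -> open_ideal tau K.
Proof.
have [Gi _ _ Go] := Gtau; move=> GK; split; first exact: Gi.
by apply/Go => x Kx; exists K => // y Ky; apply: ideal_addr => //; case: (Gi K GK).
Qed.

Lemma ideal_based_linear : linear_ring_topology tau.
Proof.
have [Gi [K0 GK0] Gd Go] := Gtau; split; last first.
  exists G => //; split=> [U GU|U].
    by apply/ideal_based_nbhs; exists U => // y; rewrite add0r.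
  by move=> /ideal_based_nbhs[K GK KU]; exists K => // y /KU; rewrite add0r.
split.
- move=> [x y] U /= /ideal_based_nbhs[K GK KU].
  have [rK KL] := Gi K GK; have [K0' KB KM] := rK.
  exists ([set z | K (z - x)], [set z | K (z - y)]) => /=.
    by split; apply/ideal_based_nbhs; exists K => // z Kz; rewrite /= addrC addKr.
  move=> [u v] /= [Ku Kv]; have -> : u + v = (x + y) + ((u - x) + (v - y)).
    by rewrite [RHS]addrACA [x + _]addrC [y + _]addrC !subrK.
  by apply: KU; exact: ideal_addr.
- move=> x U /= /ideal_based_nbhs[K GK KU]; apply/ideal_based_nbhs.
  exists K => // y Ky /=; rewrite opprD; apply: KU.
  by apply: ideal_opp => //; case: (Gi K GK).
- move=> [x y] U /= /ideal_based_nbhs[K GK KU].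
  have [rK KL] := Gi K GK; have [K0' KB KM] := rK.
  exists ([set z | K (z - x)], [set z | K (z - y)]) => /=.
    by split; apply/ideal_based_nbhs; exists K => // z Kz; rewrite /= addrC addKr.
  move=> [u v] /= [Ku Kv]; have -> : u * v = x * y + ((u - x) * v + x * (v - y)).
    by rewrite mulrBl mulrBr subrKA addrC subrK.
  by apply: KU; apply: ideal_addr => //; [exact: KM | exact: KL].
Qed.

Lemma ideal_based_hausdorff : (forall x, (forall K, G K -> K x) -> x = 0) ->
  hausdorff_ring tau.
Proof.
have [Gi _ _ _] := Gtau; move=> G0 x y xy.
apply/eqP; rewrite -subr_eq0; apply/eqP; apply: G0 => K GK.
have [rK KL] := Gi K GK; have [K0' KB KM] := rK.
have nb (z : R) : nbhs (z : T) [set w | K (w - z)].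
  by apply/ideal_based_nbhs; exists K => // w Kw; rewrite /= addrC addKr.
have [z [/= Kzx Kzy]] := xy _ _ (nb x) (nb y).
have -> : (x : R) - y = (z - y) - (z - x) by rewrite opprB [RHS]addrC subrKA.
exact: KB.
Qed.

Lemma ideal_based_quasi : (forall x, (forall K, G K -> K x) -> x = 0) ->
  (forall a, fitting G a) -> quasi_pi_regular tau.
Proof.
have [Gi [K0 GK0] Gd Go] := Gtau; move=> G0 fitR; split.
- exact: ideal_based_linear.
- exact: ideal_based_hausdorff.
- move=> a; have [e [b [ee ab ba [eb be] He]]] := fitR a; exists e => /=.
  have ea := fitting_comm ab ba; set f := 1 - e.
  have eae : e * a * e = a * e by rewrite ea -mulrA ee.
  have fa : f * a = a * f by rewrite /f mulrBl mulrBr mul1r mulr1 ea.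
  have ff : f * f = f by rewrite /f mulrBl mul1r mulrBr mulr1 ee subrr subr0.
  have faf : f * a * f = a * f by rewrite fa -mulrA ff.
  split=> //.
  + by rewrite eae faf -mulrDr /f addrC subrK mulr1.
  + exists b; rewrite eae; split; [by rewrite -mulrA be eb | by rewrite -mulrA eb | by rewrite mulrA ba].
  + have fan k : (f * a * f) ^+ k.+1 = a ^+ k.+1 * f.
      rewrite faf exprMn_comm; last by rewrite /GRing.comm fa.
      by congr (_ * _); elim: k => // k IH; rewrite exprSr IH.
    move=> U /ideal_based_nbhs[K GK KU]; have [n Hn] := He K GK.
    exists n.+1 => // k /= nk; case: k nk => // k; rewrite ltnS => nk.
    rewrite -[X in U X]add0r; apply: KU; rewrite fan -(subnK nk) -addSn exprD -mulrA.
    by case: (Gi K GK) => _; apply.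
Qed.

End IdealBased.

Lemma mx_ideal_based (R : pzRingType) (tau : topology R) n :
  ideal_based (mx_topology tau n) [set @mx_over R n I | I in open_ideal tau].
Proof.
split.
- by move=> _ [I [iI oI] <-]; exact: mx_over_ideal.
- exists (@mx_over R n setT); exists setT => //; split; last exact: is_openT.
  by split=> //; split.
- move=> _ _ [I [[[I0 IB IM] IL] oI] <-] [J [[[J0 JB JM] JL] oJ] <-].
  exists (mx_over (I `&` J)); split; last 2 first.
  + by move=> X H i j; have [] := H i j.
  + by move=> X H i j; have [] := H i j.
  exists (I `&` J) => //; split; last exact: is_openI.
  split; [split=> // | by move=> x a [/IL ? /JL ?]].
  + by move=> x y [Ix Jx] [Iy Jy]; split; [apply: IB | apply: JB].
  + by move=> x a [/IM ? /JM ?].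
- move=> U; split=> oU A UA.
    by have [I oI IU] := oU A UA; exists (mx_over I); [exists I | exact: IU].
  by have [_ [I oI <-] IU] := oU A UA; exists I.
Qed.

Lemma cvg_prod_topology (I : Type) (K : I -> topologicalType)
    (F : set_system (forall i, K i)) (t : forall i, K i) : Filter F ->
  (forall i A, nbhs (t i) A -> F [set f | A (f i)]) -> F --> (t : prod_topology K).
Proof.
move=> FF HF; apply/cvg_sup => i A; rewrite nbhsE => -[_ [[C oC <-] Ct] CA].
by apply: filterS CA _; apply: HF; exact: open_nbhs_nbhs.
Qed.

Lemma prod_topology_cylinder (I : Type) (K : I -> topologicalType) (t : forall i, K i) i A :
  nbhs (t i) A -> nbhs (t : prod_topology K) [set f | A (f i)].
Proof.
move=> At; have /cvg_sup/(_ i) : nbhs (t : prod_topology K) --> (t : prod_topology K) by exact: cvg_id.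
move=> H; apply: H; move: At; rewrite nbhsE => -[C [oC Ct] CA].
by rewrite nbhsE; exists [set f | C (f i)]; [split=> //; exists C | move=> f /CA].
Qed.

Section InverseLimitTopology.
Variable D : inverse_system.

Definition lim_ker (i : isys_index D) : set (inverse_limit D) := [set x | val x i = 0].

Lemma inverse_limit_ideal_based :
  ideal_based (inverse_limit_topology D) [set lim_ker i | i in setT].
Proof.
have kerS i j : isys_le i j -> lim_ker j `<=` lim_ker i.
  move=> ij x xj; have /asboolP/(_ i j ij) := valP x.
  by rewrite /lim_ker /= => <-; rewrite xj rmorph0.
have kerB i (x y : inverse_limit D) : val x i = val y i -> lim_ker i (x - y).
  by move=> E; apply/eqP; rewrite subr_eq0; apply/eqP.
have kerD i (x y : inverse_limit D) : lim_ker i y -> val (x + y) i = val x i.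
  by move=> E; rewrite -[RHS]addr0 -E.
have prodE i (x y : inverse_limit D) : val (x * y) i = val x i * val y i by [].
split.
- move=> _ [i _ <-]; split=> [|x a xi]; last by apply: etrans (prodE i a x) _; rewrite xi mulr0.
  split=> [//|x y xi yi|x a xi]; first by apply: kerB; rewrite xi yi.
  by apply: etrans (prodE i x a) _; rewrite xi mul0r.
- by case: (isys_inhabited D) => i; exists (lim_ker i); exists i.
- move=> _ _ [i _ <-] [j _ <-]; have [k [ik jk]] := isys_directed i j.
  by exists (lim_ker k); split; [exists k | exact: kerS | exact: kerS].
move=> U; split=> [[O oO <-] x Ox|HU].
  (* The filter generated by the cosets of the kernels at [x], by directedness; it converges in each
     coordinate, hence in the product, so [O] contains a coset. *)
  pose F : set_system (product_ring D) :=
    [set W | exists i, forall y, lim_ker i y -> W (val (x + y))].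
  have FF : Filter F.
    split=> [|P Q [i Pi] [j Qj]|P Q PQ [i Pi]].
    - by case: (isys_inhabited D) => i; exists i.
    - have [k [ik jk]] := isys_directed i j; exists k => y yk.
      by split; [apply/Pi/(kerS _ _ ik) | apply/Qj/(kerS _ _ jk)].
    - by exists i => y yi; exact/PQ/Pi.
  have Fx : F --> (val x : prod_topology (fun i => discrete_topology (D i))).
    apply: (@cvg_prod_topology _ (fun i => discrete_topology (D i)) F (val x) FF) => i A Ax.
    exists i => y yi.
    by change (A (val (x + y) i)); rewrite kerD //; exact: nbhs_singleton Ax.
  have [i Hi] : F O by apply: Fx; exact: open_nbhs_nbhs.
  by exists (lim_ker i); [exists i | exact: Hi].
pose T := prod_topology (fun i => discrete_topology (D i)).
(* A union of one-coordinate cylinders that cuts out [U] on the limit. *)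
exists [set z : T | exists2 x, U x & exists2 i, (forall y, lim_ker i y -> U (x + y)) & z i = val x i].
  rewrite openE => z [x Ux [i Ki zi]]; rewrite /interior.
  have nz := @prod_topology_cylinder _ (fun i => discrete_topology (D i)) z i [set z i] (discrete_set1 _).
  apply: (@filterS _ (nbhs (z : T)) _ _ _ _ nz) => w /= wi.
  by exists x => //; exists i; rewrite ?wi.
apply/seteqP; split=> [z /= [x Ux [i Ki zi]]|x Ux].
  by rewrite -(subrK x z) addrC; apply: Ki; exact: kerB.
by exists x => //; have [_ [i _ <-] Ki] := HU x Ux; exists i.
Qed.

Lemma lim_ker0 x : (forall i, lim_ker i x) -> x = 0.
Proof. by move=> H; apply/val_inj/functional_extensionality_dep => i; rewrite (H i). Qed.

End InverseLimitTopology.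

Lemma inverse_limit_lift (D : inverse_system) (x : forall i, D i) :
  (forall i j (h : isys_le i j), isys_map h (x j) = x i) ->
  exists y : inverse_limit D, forall i, val y i = x i.
Proof.
move=> cx; have cx' : (x : product_ring D) \in @compatible D by apply/asboolP.
by exists (exist (fun z => z \in @compatible D) (x : product_ring D) cx').
Qed.

Section LimitProjection.
Variables (D : inverse_system) (i : isys_index D).

Definition lim_proj (x : inverse_limit D) : D i := val x i.

Fact lim_proj_zmod : zmod_morphism lim_proj. Proof. by []. Qed.
Fact lim_proj_monoid : monoid_morphism lim_proj. Proof. by []. Qed.
HB.instance Definition _ := GRing.isZmodMorphism.Build _ _ lim_proj lim_proj_zmod.
HB.instance Definition _ := GRing.isMonoidMorphism.Build _ _ lim_proj lim_proj_monoid.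

End LimitProjection.

(** Exhibits [R] as the limit of [D] through its projections, without elements of
    [inverse_limit D]. *)
Record pro_presentation (R : pzRingType) (tau : topology R) (D : inverse_system)
    (h : forall i : isys_index D, {rmorphism R -> D i}) : Prop := ProPresentation {
  pro_based : ideal_based tau [set [set r | h i r = 0] | i in setT];
  pro_separated : forall r, (forall i, h i r = 0) -> r = 0;
  pro_map : forall i j (ij : isys_le i j) r, isys_map ij (h j r) = h i r;
  pro_complete : forall x : (forall i, D i),
    (forall i j (ij : isys_le i j), isys_map ij (x j) = x i) ->
    exists r, forall i, h i r = x i
}.

Lemma pro_presented (Q : pzRingType -> Prop) (R : pzRingType) (tau : topology R) :
  pro Q tau -> exists (D : inverse_system) (h : forall i : isys_index D, {rmorphism R -> D i}),
    (forall i, Q (D i)) /\ pro_presentation tau h.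
Proof.
move=> [D [QD [f [g [fK gK fC gC]]]]].
pose h i : {rmorphism R -> D i} := @lim_proj D i \o f.
have [Ki [K0 GK0] Kd Ko] := inverse_limit_ideal_based D.
have hk i : [set r | h i r = 0] = f @^-1` (@lim_ker D i) by [].
exists D, h; split=> //; split.
- split.
  + by move=> _ [i _ <-]; exact: ker_ideal.
  + by case: GK0 => i _ _; exists [set r | h i r = 0]; exists i.
  + move=> _ _ [i _ <-] [j _ <-].
    have [_ [[k _ <-] ki kj]] := Kd (lim_ker i) (lim_ker j)
      (ex_intro2 _ _ i I erefl) (ex_intro2 _ _ j I erefl).
    by exists [set r | h k r = 0]; split; [exists k | move=> r /ki | move=> r /kj].
  + move=> U; have -> : is_open tau U <-> is_open (inverse_limit_topology D) (g @^-1` U).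
      split=> oU; first by move/continuousP: gC; exact.
      suff -> : U = f @^-1` (g @^-1` U) by move/continuousP: fC; exact.
      by apply/seteqP; split=> r; rewrite /= fK.
    split=> [/Ko H r Ur|H].
      have [|_ [i _ <-] Hi] := H (f r); first by rewrite /= fK.
      exists [set r | h i r = 0]; first by exists i.
      by move=> s /Hi; rewrite /= -rmorphD fK.
    apply/Ko => x Ux; have [_ [i _ <-] Hi] := H _ Ux.
    exists (lim_ker i); first by exists i.
    move=> y yi; rewrite /= -(gK x) -(gK y) -rmorphD fK; apply: Hi.
    by rewrite /= /lim_proj gK.
- move=> r Hr; rewrite -(fK r) (_ : f r = 0); last by apply: lim_ker0 => i; exact: Hr.
  by rewrite -(rmorph0 f) fK.
- by move=> i j ij r; have /asboolP/(_ i j ij) := valP (f r).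
- move=> x /inverse_limit_lift[y Hy]; exists (g y) => i.
  by rewrite /= /lim_proj gK.
Qed.

(** From [e = e * b ^+ n' * a ^+ n'] follows [e * (1 - e') = 0], and symmetrically
    [(1 - e) * e' = 0]; so [e = e'], and [b = b * a * b' = b']. *)
Lemma fitting_unique (R : pzRingType) (a e b e' b' : R) n n' :
  [/\ a * b = e, b * a = e, e * e = e, e * b = b & b * e = b] -> a ^+ n * (1 - e) = 0 ->
  [/\ a * b' = e', b' * a = e', e' * e' = e', e' * b' = b' & b' * e' = b'] ->
  a ^+ n' * (1 - e') = 0 -> e = e' /\ b = b'.
Proof.
move=> [ab ba ee eb be] an [ab' ba' ee' eb' be'] an'.
have [_ ek] := fitting_powers n' ab ba ee eb be.
have [ek' _] := fitting_powers n ab' ba' ee' eb' be'.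
have ann : (1 - e) * a ^+ n = 0.
  rewrite -an; apply: (@commrX _ (1 - e) a n); apply: commr_sym; apply: commrB; first exact: commr1.
  by apply: commr_sym; exact: fitting_comm ab ba.
have e1 : e * (1 - e') = 0 by rewrite -ek -!mulrA an' !mulr0.
have e2 : (1 - e) * e' = 0 by rewrite -ek' !mulrA ann !mul0r.
have eE : e = e'.
  move: e1 e2; rewrite mulrBr mulrBl mulr1 mul1r => /eqP + /eqP.
  by rewrite !subr_eq0 => /eqP E1 /eqP E2; rewrite E1 -E2.
by split=> //; rewrite -be eE -ab' mulrA ba eE eb'.
Qed.

Lemma pro_fitting (R : pzRingType) (tau : topology R) (D : inverse_system)
    (h : forall i : isys_index D, {rmorphism R -> D i}) (Q : disc_property) :
  pro_presentation tau h -> (forall i, has_disc Q (D i)) ->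
  forall a, fitting [set [set r | h i r = 0] | i in setT] a.
Proof.
move=> [_ hsep hmap hcomp] QD a.
have ex i : exists eb : D i * D i,
    [/\ h i a * eb.2 = eb.1, eb.2 * h i a = eb.1, eb.1 * eb.1 = eb.1,
        eb.1 * eb.2 = eb.2 & eb.2 * eb.1 = eb.2] /\
    exists n, h i a ^+ n * (1 - eb.1) = 0.
  have [e [b [ee ab ba [eb be] He]]] := fitting_of_disc (QD i) (h i a).
  by exists (e, b); split=> //; exact: (He [set 0] erefl).
pose eb i := sval (cid (ex i)).
have Heb i := svalP (cid (ex i)).
have compat i j (ij : isys_le i j) :
    isys_map ij (eb j).1 = (eb i).1 /\ isys_map ij (eb j).2 = (eb i).2.
  have [Hi [n Hn]] := Heb i; have [[ab ba ee e_b b_e] [k Hk]] := Heb j.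
  apply: (@fitting_unique _ (h i a) _ _ _ _ k n _ _ Hi Hn).
    by rewrite -(hmap i j ij); split; rewrite -!rmorphM; congr (isys_map ij _).
  by rewrite -(hmap i j ij) -rmorphXn -[1](rmorph1 (isys_map ij)) -rmorphB -rmorphM Hk rmorph0.
have [e He] := hcomp _ (fun i j ij => (compat i j ij).1).
have [b Hb] := hcomp _ (fun i j ij => (compat i j ij).2).
have heq r s : (forall i, h i r = h i s) -> r = s.
  move=> H; apply/eqP; rewrite -subr_eq0; apply/eqP; apply: hsep => i.
  by rewrite rmorphB H subrr.
exists e, b; split; try (split; apply: heq); try apply: heq;
  try by move=> i; have [[ab ba ee e_b b_e] _] := Heb i; rewrite rmorphM ?He ?Hb.
move=> _ [i _ <-]; have [_ [n Hn]] := Heb i; exists n.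
by rewrite /= rmorphM rmorphXn rmorphB rmorph1 He.
Qed.

Section QuotientMap.
Variables (R : pzRingType) (J K : ideal_of R).
Hypothesis JK : ideal_set J `<=` ideal_set K.

Definition quot_map (q : quot_ring J) : quot_ring K := quot_class K (quot_repr q).

Lemma quot_mapE x : quot_map (quot_class J x) = quot_class K x.
Proof. by apply/quot_classP/JK/quot_classP; rewrite quot_reprK. Qed.

Fact quot_map_zmod : zmod_morphism quot_map.
Proof.
move=> q r; rewrite -[q]quot_reprK -[r]quot_reprK.
by rewrite -(raddfB (quot_class J)) !quot_mapE raddfB.
Qed.
Fact quot_map_monoid : monoid_morphism quot_map.
Proof.
split=> [|q r]; first by rewrite -(rmorph1 (quot_class J)) quot_mapE rmorph1.
rewrite -[q]quot_reprK -[r]quot_reprK.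
by rewrite -(rmorphM (quot_class J)) !quot_mapE rmorphM.
Qed.

Definition quot_morphism : {rmorphism quot_ring J -> quot_ring K} :=
  HB.pack quot_map (GRing.isZmodMorphism.Build _ _ quot_map quot_map_zmod)
    (GRing.isMonoidMorphism.Build _ _ quot_map quot_map_monoid).

Lemma quot_morphismE x : quot_morphism (quot_class J x) = quot_class K x.
Proof. exact: quot_mapE. Qed.

End QuotientMap.

Lemma fitting_morph (R R' : pzRingType) (f : {rmorphism R -> R'})
    (G : set (set R)) (G' : set (set R')) (a : R) :
  (forall K', G' K' -> exists2 K, G K & forall x, K x -> K' (f x)) ->
  fitting G a -> fitting G' (f a).
Proof.
move=> GG' [e [b [ee ab ba [eb be] He]]]; exists (f e), (f b).
split; rewrite -?rmorphM ?ee ?ab ?ba ?eb ?be // => K' /GG'[K GK KK'].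
have [n /KK' Hn] := He K GK; exists n.
by rewrite rmorphM rmorphXn rmorphB rmorph1 in Hn.
Qed.

(** * The topology of the algebra defined by the open ideals of [S] *)

Section AlgebraTopology.
Variables (S : comPzRingType) (tau : topology S) (R : pzRingType) (phi : {rmorphism S -> R}).

Definition algebra_open (U : set R) : Prop :=
  forall x, U x -> exists2 J, open_ideal tau J & forall y, smulR phi J y -> U (x + y).

Lemma open_idealT : open_ideal tau setT.
Proof. by split; [split; [split|] | exact: is_openT]. Qed.

Lemma open_idealI I J : open_ideal tau I -> open_ideal tau J -> open_ideal tau (I `&` J).
Proof.
move=> [[[I0 IB IM] IL] oI] [[[J0 JB JM] JL] oJ]; split; last exact: is_openI.
split; [split=> // | by move=> x a [/IL ? /JL ?]].
- by move=> x y [Ix Jx] [Iy Jy]; split; [apply: IB | apply: JB].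
- by move=> x a [/IM ? /JM ?].
Qed.

Fact algebra_openT : algebra_open setT.
Proof. by move=> x _; exists setT => //; exact: open_idealT. Qed.

Fact algebra_openI : setI_closed algebra_open.
Proof.
move=> U V oU oV x [Ux Vx]; have [I oI IU] := oU x Ux; have [J oJ JV] := oV x Vx.
exists (I `&` J); first exact: open_idealI.
by move=> y Hy; split; [apply: IU | apply: JV]; apply: smulR_mono Hy => z [].
Qed.

Fact algebra_open_bigU (K : Type) (f : K -> set R) :
  (forall k, algebra_open (f k)) -> algebra_open (\bigcup_k f k).
Proof.
by move=> of_ x [k _ fkx]; have [I oI If] := of_ k x fkx; exists I => // y /If fy; exists k.
Qed.

Definition algebra_topology : topology R :=
  Topology algebra_openT algebra_openI algebra_open_bigU.

Hypothesis phi_central : central_morphism phi.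

Lemma algebra_ideal_based :
  ideal_based algebra_topology [set smulR phi J | J in open_ideal tau].
Proof.
split.
- by move=> _ [J oJ <-]; exact: smulR_ideal.
- by exists (smulR phi setT), setT => //; exact: open_idealT.
- move=> _ _ [I oI <-] [J oJ <-]; exists (smulR phi (I `&` J)); split.
  + by exists (I `&` J) => //; exact: open_idealI.
  + by apply: smulR_mono => z [].
  + by apply: smulR_mono => z [].
- move=> U; split=> oU x Ux.
    by have [J oJ JU] := oU x Ux; exists (smulR phi J) => //; exists J.
  by have [_ [J oJ <-] JU] := oU x Ux; exists J.
Qed.

Lemma algebra_separated : hausdorff_module tau (algebra_module phi) ->
  forall x, (forall J, open_ideal tau J -> smulR phi J x) -> x = 0.
Proof.
move=> H x Hx; suff : [set 0] (x : algebra_module phi) by [].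
rewrite -H => J oJ; have [l Hl ->] := Hx J oJ.
exists (size l), (fun i => (tnth (in_tuple l) i).1), (fun i => (tnth (in_tuple l) i).2).
split=> [i|]; first by apply: Hl; exact: mem_tnth.
by rewrite big_tnth.
Qed.

Hypothesis R0 : forall x, (forall J, open_ideal tau J -> smulR phi J x) -> x = 0.
Hypothesis fitN : forall N (A : 'M[R]_N),
  fitting [set @mx_over R N (smulR phi J) | J in open_ideal tau] A.

Lemma algebra_quasi_inf : quasi_pi_inf_regular algebra_topology.
Proof.
have based := algebra_ideal_based; split.
- exact: ideal_based_linear based.
- by apply: ideal_based_hausdorff based _ => x Hx; apply: R0 => J oJ; apply: Hx; exists J.
move=> N _; apply: ideal_based_quasi (mx_ideal_based algebra_topology N) _ _.
- move=> X HX; apply/matrixP => i j; rewrite mxE; apply: R0 => J oJ.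
  apply: (HX (mx_over (smulR phi J))); exists (smulR phi J) => //.
  by apply: (ideal_based_open_ideal based); exists J.
- move=> A; apply: fitting_mono (fitN A) => _ [I [iI oI] <-].
  have I0 : I 0 by case: iI => [[]].
  (* Matrix neighbourhoods come from arbitrary open ideals of [R]; each of these contains some
     [smulR phi J]. *)
  have [J oJ JI] := oI 0 I0; exists (mx_over (smulR phi J)); first by exists J.
  by move=> X HX i j; rewrite -[X i j]add0r; exact: JI.
Qed.

End AlgebraTopology.

(** * The algebra as an inverse limit *)

Section ProAlgebra.
Variables (S : comPzRingType) (tau : topology S) (D : inverse_system)
  (h : forall i : isys_index D, {rmorphism S -> D i}).
Hypothesis pS : pro_presentation tau h.
Local Notation ker i := [set s : S | h i s = 0].

Lemma ker_mono i j : isys_le i j -> ker j `<=` ker i.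
Proof. by move=> ij s /= E; rewrite -(pro_map pS ij) E rmorph0. Qed.

Lemma ker_open i : open_ideal tau (ker i).
Proof. by apply: (ideal_based_open_ideal (pro_based pS)); exists i. Qed.

Lemma ker_sub J : open_ideal tau J -> exists i, ker i `<=` J.
Proof.
move=> [[[J0 _ _] _] oJ]; have [_ _ _ Ho] := pro_based pS.
by have [_ [i _ <-] iJ] := (Ho J).1 oJ 0 J0; exists i => s /iJ; rewrite add0r.
Qed.

(* The only use of first countability. *)
Lemma pro_cofinal : first_countable_ring tau -> exists j : nat -> isys_index D,
  (forall k, isys_le (j k) (j k.+1)) /\ forall i, exists k, ker (j k) `<=` ker i.
Proof.
move=> [B /pcard_injP[f finj] [Bn Bsub]].
have ltau := ideal_based_linear (pro_based pS).
(* [f] numbers the countable basis injectively, so at most one [V] has number [k]; any index will do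
   if there is none. *)
have Hi k : exists i, forall V, B V -> f V = k -> ker i `<=` V.
  have [[V [BV fV]]|nV] := pselect (exists V, B V /\ f V = k).
    have [J oJ JV] := open_idealP ltau (Bn V BV); have [i iJ] := ker_sub oJ.
    exists i => W BW fW; have -> : W = V by apply: finj; rewrite ?inE // fW fV.
    exact: subset_trans JV.
  by case: (isys_inhabited D) => i; exists i => V BV fV; case: nV; exists V.
have [idx Hidx] := choice Hi.
have up a k : exists b, isys_le a b /\ isys_le (idx k) b by exact: isys_directed.
have [u Hu] := choice (fun ak : isys_index D * nat => up ak.1 ak.2).
pose j := fix j k := if k is l.+1 then u (j l, k) else idx 0%N.
have jidx k : isys_le (idx k) (j k).
  by case: k => [|k]; [exact: isys_refl | case: (Hu (j k, k.+1))].
exists j; split=> [k|i]; first by case: (Hu (j k, k.+1)).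
have ni : nbhs (0 : topologized tau) (ker i).
  by apply/(ideal_based_nbhs (pro_based pS)); exists (ker i) => [|y]; [exists i | rewrite add0r].
have [V BV Vi] := Bsub _ ni; exists (f V).
by apply: subset_trans Vi; apply: subset_trans (Hidx _ V BV erefl); exact: ker_mono.
Qed.

(** Completeness of [S]: all terms from [k] on die in [D i] once [ker (j k)] lies in [ker i], so the
    partial sums become constant in each [D i], and the eventual values are compatible. *)
Lemma pro_limit (j : nat -> isys_index D) (c : nat -> S) :
  (forall k, isys_le (j k) (j k.+1)) -> (forall i, exists k, ker (j k) `<=` ker i) ->
  (forall k, h (j k) (c k) = 0) ->
  exists s, forall k, h (j k) (s - \sum_(0 <= l < k) c l) = 0.
Proof.
move=> jS jcof c0; pose sg k := \sum_(0 <= l < k) c l.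
have jle k l : (k <= l)%N -> isys_le (j k) (j l).
  move=> /subnK <-; elim: (l - k)%N => [|m IH]; first exact: isys_refl.
  exact: isys_trans IH (jS _).
have sgE i k l : ker (j k) `<=` ker i -> ker (j l) `<=` ker i -> h i (sg k) = h i (sg l).
  wlog kl : k l / (k <= l)%N => [W ki li|ki _].
    by have [kl|/ltnW lk] := leqP k l; [exact: W | apply/esym; exact: W].
  apply/esym/eqP; rewrite -subr_eq0 -rmorphB /sg (@big_cat_nat _ _ _ k) //= addrAC subrr add0r.
  rewrite rmorph_sum big_nat big1 // => m /andP[km _].
  by apply: ki; apply: (ker_mono (jle k m km)); exact: c0.
have [kk Hkk] := choice jcof.
have [|s Hs] := pro_complete pS (x := fun i => h i (sg (kk i))).
  move=> i i' ii'; rewrite (pro_map pS); apply: sgE; last exact: Hkk.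
  by apply: subset_trans (ker_mono ii'); exact: Hkk.
by exists s => k; rewrite rmorphB Hs (sgE _ _ k) ?subrr //; exact: Hkk.
Qed.

Variables (R : pzRingType) (phi : {rmorphism S -> R}).
Hypothesis phi_central : central_morphism phi.
Variables (n : nat) (g : 'I_n -> R).
Hypothesis g_gen : forall x, exists c, x = \sum_(i < n) phi (c i) * g i.
Hypothesis R0 : forall x, (forall J, open_ideal tau J -> smulR phi J x) -> x = 0.

Lemma smulR_gen (J : set S) x : two_sided_ideal J -> smulR phi J x ->
  exists2 c, (forall i, J (c i)) & x = \sum_(i < n) phi (c i) * g i.
Proof.
move=> [[J0 JB JM] JL] [l Hl ->]; elim: l Hl => [|p l IH] Hl.
  exists (fun=> 0) => //; rewrite big_nil big1 // => i _; by rewrite rmorph0 mul0r.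
have [c Jc E] := IH (fun q ql => Hl q (mem_behead (s := p :: l) ql)).
have [d pE] := g_gen p.2; exists (fun i => p.1 * d i + c i) => [i|].
  by apply: ideal_addr => //; apply: JM; exact: Hl (mem_head _ _).
rewrite big_cons E {1}pE mulr_sumr -big_split /=; apply: eq_bigr => i _.
by rewrite rmorphD rmorphM mulrDl mulrA.
Qed.

Definition quot_ideal i := IdealOf (smulR_ideal phi_central (ker i)).

Lemma quot_ideal_mono i j : isys_le i j ->
  ideal_set (quot_ideal j) `<=` ideal_set (quot_ideal i).
Proof. by move=> ij; apply: smulR_mono; exact: ker_mono. Qed.

Definition quot_isys_map i j (ij : isys_le i j) := quot_morphism (quot_ideal_mono ij).

Fact quot_isys_id i (ii : isys_le i i) x : quot_isys_map ii x = x.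
Proof. by rewrite -[x]quot_reprK quot_morphismE. Qed.

Fact quot_isys_comp i j k (ij : isys_le i j) (jk : isys_le j k) (ik : isys_le i k) x :
  quot_isys_map ij (quot_isys_map jk x) = quot_isys_map ik x.
Proof.
rewrite -[x]quot_reprK; set r := quot_repr x.
have jkE : quot_isys_map jk (quot_class _ r) = quot_class _ r by exact: quot_morphismE.
by rewrite jkE; apply: etrans (quot_morphismE _ _) (esym (quot_morphismE _ _)).
Qed.

Definition quot_isys : inverse_system :=
  InverseSystem (@isys_refl D) (@isys_trans D) (isys_inhabited D) (@isys_directed D)
    quot_isys_id quot_isys_comp.

Definition to_limit_fun (r : R) : product_ring quot_isys :=
  fun i => quot_class (quot_ideal i) r.

Fact to_limit_compatible r : to_limit_fun r \in @compatible quot_isys.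
Proof. by apply/asboolP => i j ij; exact: quot_morphismE. Qed.

Definition to_limit (r : R) : inverse_limit quot_isys :=
  exist (fun z => z \in @compatible quot_isys) _ (to_limit_compatible r).

Fact to_limit_zmod : zmod_morphism to_limit.
Proof.
move=> x y; apply/val_inj/functional_extensionality_dep => i.
exact: (raddfB (quot_class (quot_ideal i))).
Qed.
Fact to_limit_monoid : monoid_morphism to_limit.
Proof.
split=> [|x y]; apply/val_inj/functional_extensionality_dep => i.
  exact: (rmorph1 (quot_class (quot_ideal i))).
exact: (rmorphM (quot_class (quot_ideal i))).
Qed.
HB.instance Definition _ := GRing.isZmodMorphism.Build R _ to_limit to_limit_zmod.
HB.instance Definition _ := GRing.isMonoidMorphism.Build R _ to_limit to_limit_monoid.

Lemma to_limit_inj r : to_limit r = 0 -> r = 0.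
Proof.
move=> r0; apply: R0 => J /ker_sub[i iJ]; apply: (smulR_mono iJ).
by apply/(quot_class_eq0 (quot_ideal i)); rewrite -[LHS]/(val (to_limit r) i) r0.
Qed.

(** Consecutive representatives along the cofinal sequence differ by an element with coordinates
    over [g] in [ker (j k)]. The coordinate series converge in [S] by [pro_limit], and their sums
    correct the first representative. *)
Lemma to_limit_surj : first_countable_ring tau -> forall x, exists r, to_limit r = x.
Proof.
move=> /pro_cofinal[j [jS jcof]] x.
have compat i i' (ii' : isys_le i i') : quot_isys_map ii' (val x i') = val x i.
  by have /asboolP := valP x; apply.
pose rr i := quot_repr (val x i : quot_ring (quot_ideal i)).
have rrE i i' (ii' : isys_le i i') : quot_class (quot_ideal i) (rr i') = val x i.
  by rewrite -(compat i i' ii') -[in RHS](quot_reprK (val x i')) quot_morphismE.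
have step k : exists c : 'I_n -> S, (forall i, h (j k) (c i) = 0) /\
    rr (j k.+1) - rr (j k) = \sum_(i < n) phi (c i) * g i.
  have [||c c0 E] := @smulR_gen (ker (j k)) (rr (j k.+1) - rr (j k)); last by exists c.
    exact: ker_ideal.
  apply/(quot_classP (quot_ideal (j k))).
  by rewrite (rrE _ _ (jS k)) (rrE _ _ (isys_refl _)).
have [c Hc] := choice step.
have [s Hs] := choice (fun i => pro_limit jS jcof (fun k => (Hc k).1 i)).
pose r := rr (j 0%N) + \sum_(i < n) phi (s i) * g i.
have rrk k : rr (j k) = rr (j 0%N) + \sum_(i < n) phi (\sum_(0 <= l < k) c l i) * g i.
  elim: k => [|k IH].
    by rewrite big1 ?addr0 // => i _; rewrite big_nil rmorph0 mul0r.
  rewrite -[LHS](subrK (rr (j k))) (Hc k).2 IH addrCA -big_split /=; congr (_ + _).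
  by apply: eq_bigr => i _; rewrite big_nat_recr //= rmorphD mulrDl addrC.
have rk k : smulR phi (ker (j k)) (rr (j k) - r).
  rewrite rrk /r opprD addrACA subrr add0r -sumrB.
  apply: ideal_sum => [|i _]; first exact: smulR_right_ideal.
  rewrite -mulrBl -rmorphB; apply: smulR_mem.
  by rewrite /= -opprB rmorphN Hs oppr0.
exists r; apply/val_inj/functional_extensionality_dep => i.
(* Cofinality concerns kernels only, so [j k] need not dominate [i]; the upper bound [b] connects
   the two. *)
have [k ki] := jcof i; have [b [ib kb]] := isys_directed i (j k).
rewrite -[RHS](rrE _ _ ib); apply/esym/quot_classP/(smulR_mono ki).
rewrite -(subrK (rr (j k)) (rr b)) -addrA; apply: ideal_addr.
- exact: smulR_right_ideal.
- by apply/(quot_classP (quot_ideal (j k))); rewrite (rrE _ _ kb) (rrE _ _ (isys_refl _)).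
- exact: rk.
Qed.

Lemma algebra_pro (Q : pzRingType -> Prop) : first_countable_ring tau ->
  (forall i, Q (quot_ring (quot_ideal i))) -> pro Q (algebra_topology tau phi).
Proof.
move=> fc QR; have [f Hf] := choice (to_limit_surj fc).
have toK : cancel to_limit f.
  move=> r; apply/eqP; rewrite -subr_eq0; apply/eqP; apply: to_limit_inj.
  by rewrite (rmorphB to_limit) /= Hf subrr.
exists quot_isys; split=> //; exists to_limit, f; split=> //.
- apply/continuousP => U oU.
  have [_ _ _ Ho] := inverse_limit_ideal_based quot_isys.
  move=> x Ux; have [_ [i _ <-] iU] := (Ho U).1 oU _ Ux.
  exists (ker i); first exact: ker_open.
  move=> y yi; rewrite /= rmorphD; apply: iU.
  exact/(quot_class_eq0 (quot_ideal i)).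
- apply/continuousP => U oU.
  have [_ _ _ Ho] := inverse_limit_ideal_based quot_isys.
  apply/(Ho (f @^-1` U)) => y Uy; have [J /ker_sub[i iJ] JU] := oU _ Uy.
  exists (@lim_ker quot_isys i); first by exists i.
  move=> z zi; have -> : y + z = to_limit (f y + f z) by rewrite (rmorphD to_limit) /= !Hf.
  rewrite /= toK; apply: JU; apply: (smulR_mono iJ).
  by apply/(quot_class_eq0 (quot_ideal i)); rewrite -[LHS]/(val (to_limit (f z)) i) Hf.
Qed.

(** [finite_algebra_disc] with [U = D i]. The pi_inf-regularity it asks for comes from the
    decompositions over [R], because the ideal [smulR phi (ker i)] becomes zero in the quotient. *)
Lemma quot_disc (Q : disc_property) :
  (forall i, has_disc Q (D i)) ->
  (forall N (A : 'M[R]_N),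
     fitting [set @mx_over R N (smulR phi J) | J in open_ideal tau] A) ->
  forall i, has_disc Q (quot_ring (quot_ideal i)).
Proof.
move=> QD fitN i; pose cl : {rmorphism R -> quot_ring (quot_ideal i)} := quot_class _.
apply: (@finite_algebra_disc S _ (D i) (cl \o phi) (h i) n (cl \o g)).
- move=> s q; rewrite -[q]quot_reprK /=.
  by rewrite -!(rmorphM cl) phi_central.
- move=> q; have [c E] := g_gen (quot_repr q); exists c.
  rewrite -[q]quot_reprK E -/(cl _) rmorph_sum.
  by apply: eq_bigr => k _; rewrite rmorphM.
- move=> s s0; apply/(quot_class_eq0 (quot_ideal i)); rewrite -[phi s]mulr1.
  exact: smulR_mem.
- move=> a; apply: fitting_mono (pro_fitting pS QD a) => _ ->.
  by exists (ker i) => //; exists i.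
- move=> N _; apply: pi_regular_of_fitting => A.
  have -> : A = map_mx cl (map_mx (@quot_repr _ _) A).
    by apply/matrixP => a b; rewrite !mxE; exact/esym/quot_reprK.
  apply: fitting_morph (fitN N _) => _ ->.
  exists (mx_over (smulR phi (ker i))); first by exists (ker i) => //; exact: ker_open.
  move=> X HX; apply/matrixP => a b; rewrite !mxE.
  exact/(quot_class_eq0 (quot_ideal i))/HX.
- exact: QD.
Qed.

End ProAlgebra.

(** * From the topological properties to matrix decompositions, and the theorem *)

Section MatrixEntry.
Variable R : pzRingType.

Definition mx11_entry (A : 'M[R]_1) : R := A 0 0.

Fact mx11_entry_zmod : zmod_morphism mx11_entry.
Proof. by move=> A B; rewrite /mx11_entry !mxE. Qed.
Fact mx11_entry_monoid : monoid_morphism mx11_entry.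
Proof.
split=> [|A B]; first by rewrite /mx11_entry mxE.
by apply: etrans (mxE _ _ _ _) _; rewrite big_ord_recl big_ord0 addr0.
Qed.
HB.instance Definition _ := GRing.isZmodMorphism.Build 'M[R]_1 R mx11_entry mx11_entry_zmod.
HB.instance Definition _ := GRing.isMonoidMorphism.Build 'M[R]_1 R mx11_entry mx11_entry_monoid.

Lemma fitting_mx11 (F : set (set R)) :
  (forall A : 'M[R]_1, fitting [set @mx_over R 1 J | J in F] A) -> forall a, fitting F a.
Proof.
move=> fitM a; have -> : a = mx11_entry (const_mx a) by rewrite /mx11_entry mxE.
apply: fitting_morph (fitM _) => J FJ.
by exists (mx_over J) => [|A]; [exists J | exact].
Qed.

(** A presentation may have no generators or no relations, whereas matrix rings are only assumed to
    have the property in positive size. *)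
Lemma fitting_mx0 (G : set (set 'M[R]_0)) A :
  (forall K, G K -> K 0) -> fitting G A.
Proof.
have E (X Y : 'M[R]_0) : X = Y by rewrite (thinmx0 X) (thinmx0 Y).
move=> G0; exists 0, 0; split; try exact: E; first by split; exact: E.
by move=> K GK; exists 0%N; rewrite [X in K X](E _ 0); exact: G0.
Qed.

End MatrixEntry.

Lemma pro_hausdorff (Q : pzRingType -> Prop) (R : pzRingType) (tau : topology R) :
  pro Q tau -> hausdorff_ring tau.
Proof.
move=> /pro_presented[D [h [_ pR]]]; apply: (ideal_based_hausdorff (pro_based pR)) => x Hx.
by apply: (pro_separated pR) => i; apply: (Hx [set r | h i r = 0]); exists i.
Qed.

Lemma fitting_of_pro (Q : disc_property) (R : pzRingType) (tau : topology R)
    (G : set (set R)) :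
  (forall K, G K -> nbhs (0 : topologized tau) K) -> pro (has_disc Q) tau ->
  forall a, fitting G a.
Proof.
move=> Gn /pro_presented[D [h [QD pR]]] a; apply: fitting_mono (pro_fitting pR QD a) => K GK.
have [K' GK' KK'] := (ideal_based_nbhs (pro_based pR) _ _).1 (Gn K GK).
by exists K' => // y /KK'; rewrite add0r.
Qed.

Lemma has_top_hausdorff (P : top_property) (R : pzRingType) (tau : topology R) :
  has_top P tau -> hausdorff_ring tau.
Proof.
by case: P => [Q /pro_hausdorff|Q [/pro_hausdorff]|[]|[[]]|[]|[[]]].
Qed.

Lemma fitting_mx_of_quasi_inf (S : pzRingType) (tau : topology S) :
  quasi_pi_inf_regular tau ->
  forall k (A : 'M[S]_k), fitting [set @mx_over S k J | J in open_ideal tau] A.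
Proof.
move=> [_ _ q]; case=> [|k] A; last first.
  by apply: (fitting_of_quasi _ (q k.+1 isT)) => K; exact: (mx_topology_local_basis tau k.+1).1.
by apply: fitting_mx0 => _ [J [[[J0 _ _] _] _] <-] i j; rewrite mxE.
Qed.

(** Quasi-pi_inf-regularity speaks of matrices already; any other [P] passes to the matrix rings by
    Morita invariance and gives the decompositions there. *)
Lemma fitting_mx_of_morita (P : top_property) (S : pzRingType) (tau : topology S) :
  linear_ring_topology tau -> morita_preserved P -> has_top P tau ->
  forall k (A : 'M[S]_k), fitting [set @mx_over S k J | J in open_ideal tau] A.
Proof.
move=> ltau mP Ptau; have [PM _] := mP S tau ltau (has_top_hausdorff Ptau) Ptau.
case: P mP Ptau PM => [Q|Q||||] _ Ptau PM.
3: exact: fitting_mx_of_quasi_inf.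
3: by case: Ptau => /fitting_mx_of_quasi_inf.
all: case=> [|k] A; first by apply: fitting_mx0 => _ [J [[[J0 _ _] _] _] <-] i j; rewrite mxE.
all: have PMk := PM k.+1 isT.
all: have Gn := (mx_topology_local_basis tau k.+1).1.
- exact: (fitting_of_pro Gn PMk).
- exact: (fitting_of_pro Gn PMk.1).
- exact: (fitting_of_quasi Gn PMk).
- exact: (fitting_of_quasi Gn PMk.1).
Qed.

Theorem corollary8p5 (S : comPzRingType) (tau : topology S)
    (R : pzRingType) (phi : {rmorphism S -> R}) :
  linear_ring_topology tau ->
  central_morphism phi ->
  finitely_presented (algebra_module phi) ->
  hausdorff_module tau (algebra_module phi) ->
  (quasi_pi_inf_regular tau ->
     (exists tauR : topology R,
        linear_ring_topology tauR /\ quasi_pi_inf_regular tauR) /\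
     (semiperfect S -> semiperfect R)) /\
  (forall P : top_property, morita_preserved P ->
     has_top P tau -> first_countable_ring tau ->
     exists tauR : topology R, linear_ring_topology tauR /\ has_top P tauR).
Proof.
move=> ltau phiC fpR hR; have R0 := algebra_separated hR.
have Fideal J : open_ideal tau J -> two_sided_ideal J by case.
have [n [g g_gen]] : exists n (g : 'I_n -> R),
    forall x, exists c, x = \sum_(i < n) phi (c i) * g i.
  have [m [n [B [p [psurj pker]]]]] := fpR.
  exists n, (fun i => p (delta_mx 0 i)) => x; have [v _ <-] := psurj x I.
  by exists (v 0); exact: presentation_gen.
have fitR : hausdorff_ring tau ->
    (forall k (A : 'M[S]_k), fitting [set @mx_over S k J | J in open_ideal tau] A) ->
    forall N (A : 'M[R]_N),
      fitting [set @mx_over R N (smulR phi J) | J in open_ideal tau] A.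
  move=> htau fitM.
  exact: (fitting_matrix_algebra Fideal (hausdorff_open_ideal ltau htau) fitM phiC R0 fpR).
have spR : hausdorff_ring tau ->
    (forall k (A : 'M[S]_k), fitting [set @mx_over S k J | J in open_ideal tau] A) ->
    semiperfect S -> semiperfect R.
  move=> htau fitM [slS _].
  have S0 x : x = 0 <-> forall J, open_ideal tau J -> J x.
    by split=> [-> J /Fideal[[]]|]; [| exact: hausdorff_open_ideal].
  (* The semilocal ring is [S] itself here; [S0] says that the kernel of the identity is the
     intersection of the open ideals. *)
  have [us [us1 Hus]] := local_decomp (h := idfun) Fideal (fitting_mx11 (fitM 1%N)) S0 slS.
  apply: (finite_algebra_semiperfect (F := open_ideal tau) phiC us1 _ g_gen
    (G := [set smulR phi J | J in open_ideal tau])).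
  - move=> t tus s; have [|[s' E]] := Hus t tus s; [by left | right].
    by exists s'; rewrite [X in phi X]E rmorph0.
  - by move=> _ [J oJ <-]; exact: smulR_ideal.
  - by move=> x Hx; apply: R0 => J oJ; apply: Hx; exists J.
  - move=> _ [J oJ <-]; exists J => // s Js; rewrite -[phi s]mulr1; exact: smulR_mem.
  - apply: fitting_mx11 => A; apply: fitting_mono (fitR htau fitM 1%N A).
    by move=> _ [_ [J oJ <-] <-]; exists (mx_over (smulR phi J)) => //; exists J.
have ltauR : linear_ring_topology (algebra_topology tau phi).
  exact: ideal_based_linear (algebra_ideal_based tau phiC).
split=> [qS|P mP PS fc].
  have [_ htau _] := qS; have fitM := fitting_mx_of_quasi_inf qS.
  split; last exact: spR.
  by exists (algebra_topology tau phi); split=> //; apply: algebra_quasi_inf => //; exact: fitR.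
have htau := has_top_hausdorff PS.
have fitM := fitting_mx_of_morita ltau mP PS.
exists (algebra_topology tau phi); split=> //.
have qiR : quasi_pi_inf_regular (algebra_topology tau phi).
  by apply: algebra_quasi_inf => //; exact: fitR.
have qR : quasi_pi_regular (algebra_topology tau phi).
  apply: (ideal_based_quasi (algebra_ideal_based tau phiC)).
    by move=> x Hx; apply: R0 => J oJ; apply: Hx; exists J.
  apply: fitting_mx11 => A; apply: fitting_mono (fitR htau fitM 1%N A).
  by move=> _ [_ [J oJ <-] <-]; exists (mx_over (smulR phi J)) => //; exists J.
have proR Q : pro (has_disc Q) tau -> pro (has_disc Q) (algebra_topology tau phi).
  move=> /pro_presented[D [h [QD pS]]].
  apply: (algebra_pro pS (phi_central := phiC) g_gen R0 fc).
  exact: (quot_disc pS phiC g_gen QD (fitR htau fitM)).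
case: P mP PS => [Q|Q||||] _ //= PS.
- exact: proR.
- by case: PS => /proR ? /(spR htau fitM).
- by case: PS => _ /(spR htau fitM).
- by case: PS => _ /(spR htau fitM).
Qed.
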